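(* Let $\Omega\subset\mathbb{R}^n$ be an open, bounded domain with outward unit normal $\nu$ on $\partial\Omega$. Let $u\in C^2(\Omega)\cap C^1(\overline{\Omega})$ be a solution of the Monge–Ampère equation $$\det(\nabla^2u)=f(x,u,\nabla u)\quad\text{in }\Omega,$$ and assume that $\inf_{\partial\Omega}\frac{\partial u}{\partial\nu}>0$. Then $$\inf_{\partial\Omega}\frac{\partial u}{\partial\nu}\le\left(\frac{\|f\|_{L^1(\Gamma_u)}}{|B_1|}\right)^{1/n}.$$
   Context: The lower contact set of $u$ is $\Gamma_u:=\{x\in\Omega:\ u(y)\ge u(x)+\nabla u(x)\cdot(y-x)\ \ \forall y\in\overline{\Omega}\}$. $\|f\|_{L^1(\Gamma_u)}$ denotes the $L^1(\Gamma_u)$ norm of $x\mapsto f(x,u(x),\nabla u(x))$. $B_1$ is the unit ball of $\mathbb{R}^n$ and $|B_1|$ its Lebesgue measure; $\frac{\partial u}{\partial\nu}=\nabla u\cdot\nu$. *)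

(* Defs.v *)
From HB Require Import structures.
From mathcomp Require Import all_boot all_order all_algebra.
From mathcomp Require Import all_classical all_reals all_analysis.
From mathcomp Require Import lra.

Set Implicit Arguments.
Unset Strict Implicit.
Unset Printing Implicit Defensive.

Import Order.TTheory GRing.Theory Num.Theory.
Import numFieldNormedType.Exports.

Local Open Scope classical_set_scope.
Local Open Scope ring_scope.

(* R^n is 'rV[R]_n. Its library norm `|x| is the sup norm, so the Euclidean
   structure is introduced separately; topology and boundedness are the same
   for both norms. *)

Definition dotv (R : realType) (n : nat) (x y : 'rV[R]_n) : R :=
  \sum_(i < n) x ord0 i * y ord0 i.

Definition enorm (R : realType) (n : nat) (x : 'rV[R]_n) : R :=
  Num.sqrt (dotv x x).

Definition eball (R : realType) (n : nat) (x : 'rV[R]_n) (r : R) :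
  set 'rV[R]_n := [set y | enorm (y - x) < r].

(* Lebesgue measure on R^n. The sigma-algebra is the one generated by the
   coordinates; it is the Borel sigma-algebra, see open_measurable_rV. *)

Section measurable_rV.
Context (R : realType) (n : nat).

Let coord (i : 'I_n) (x : 'rV[R]_n) : measurableTypeR R := x ord0 i.

HB.instance Definition _ := @isMeasurable.Build default_measure_display
  'rV[R]_n (g_sigma_preimage coord) (@sigma_algebra0 _ _ _)
  (@sigma_algebraC _ _) (@sigma_algebra_bigcup _ _ _).

End measurable_rV.

Lemma measurable_coord (R : realType) (n : nat) (i : 'I_n) :
  measurable_fun [set: 'rV[R]_n] (fun x => x ord0 i : measurableTypeR R).
Proof.
move=> _ Y mY; rewrite setTI; apply: sub_sigma_algebra => /=.
rewrite -bigcup_seq/=; exists i => /=; first by rewrite mem_index_enum.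
by exists Y => //; rewrite setTI.
Qed.

Lemma measurable_fun_rV (R : realType) (n : nat) (d : measure_display)
    (T : measurableType d) (f : T -> 'rV[R]_n) :
  (forall i, measurable_fun setT (fun t => f t ord0 i : measurableTypeR R)) ->
  measurable_fun setT f.
Proof.
move=> mf _ A mA; rewrite setTI; move: A mA.
apply: smallest_sub.
  split=> [|A mA|F mF]; rewrite /= ?setTD.
  - by rewrite preimage_set0.
  - by rewrite preimage_setC; exact: measurableC.
  - by rewrite preimage_bigcup; exact: bigcupT_measurable.
case: n => [|n] in f mf *; first by rewrite big_ord0.
rewrite -bigcup_mkord_ord; apply: bigcup_sub => i Ii.
move=> A [B mB <-].
by have := mf (inord i) measurableT B mB; rewrite !setTI.
Qed.

(* The identification R^n x R = R^(n+1); the real number becomes the last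
   coordinate. *)
Definition rV_append (R : realType) (n : nat)
    (p : 'rV[R]_n * measurableTypeR R) : 'rV[R]_n.+1 :=
  \row_(i < n.+1) if unlift ord_max i is Some j then p.1 ord0 j else p.2.

Lemma measurable_rV_append (R : realType) (n : nat) :
  measurable_fun setT (@rV_append R n).
Proof.
apply: measurable_fun_rV => i.
case: (unliftP ord_max i) => [j ->|->].
- rewrite [X in measurable_fun _ X](_ : _ = (fun x : 'rV[R]_n => x ord0 j : measurableTypeR R) \o fst).
    by apply: measurableT_comp => //; exact: measurable_coord.
  by apply/funext => p /=; rewrite mxE liftK.
- rewrite [X in measurable_fun _ X](_ : _ = snd) //.
  by apply/funext => p /=; rewrite mxE unlift_none.
Qed.

Section pushforward_append.
Context (R : realType) (n : nat) (mu : {measure set 'rV[R]_n -> \bar R}).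

Definition product_rV : set 'rV[R]_n.+1 -> \bar R :=
  pushforward (mu \x lebesgue_measure)%E (@rV_append R n).

HB.instance Definition _ := Measure.copy product_rV
  (measure_function_pushforward__canonical__measure_function_Measure (mu \x lebesgue_measure)%E (@measurable_rV_append R n)).
End pushforward_append.

Fixpoint lebesgue_rV (R : realType) (n : nat) :
    {measure set 'rV[R]_n -> \bar R} :=
  match n with
  | 0 => \d_ (0 : 'rV[R]_0)
  | m.+1 => product_rV (lebesgue_rV R m)
  end.

Lemma measurable_box (R : realType) (n : nat) (A : 'I_n -> set (measurableTypeR R)) :
  (forall i, measurable (A i)) ->
  measurable [set x : 'rV[R]_n | forall i, A i (x ord0 i)].
Proof.
move=> mA.
rewrite [X in measurable X](_ : _ = \bigcap_(i in [set: 'I_n])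
  ((fun x : 'rV[R]_n => x ord0 i : measurableTypeR R) @^-1` A i)).
  apply: fin_bigcap_measurable => // i _.
  by rewrite -[X in measurable X]setTI; exact: measurable_coord.
by apply/seteqP; split => x /= => [h i _|h i]; apply: h.
Qed.

Lemma lebesgue_rV_box (R : realType) (n : nat) (a b : 'rV[R]_n) :
  (forall i, a ord0 i <= b ord0 i) ->
  lebesgue_rV R n [set x | forall i, a ord0 i <= x ord0 i <= b ord0 i] =
  (\prod_(i < n) (b ord0 i - a ord0 i))%:E.
Proof.
elim: n a b => [|n IHn] a b ab.
  rewrite big_ord0 /= diracE mem_set//= => i; by case: i.
pose l (c : 'rV[R]_n.+1) : 'rV[R]_n := \row_j c ord0 (lift ord_max j).
pose B := [set x : 'rV[R]_n | forall i, l a ord0 i <= x ord0 i <= l b ord0 i].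
pose I : set (measurableTypeR R) := `[a ord0 ord_max, b ord0 ord_max]%classic.
have mB : measurable B.
  apply: (@measurable_box R n (fun i => `[l a ord0 i, l b ord0 i]%classic)) => i.
  exact: measurable_itv.
have mI : measurable I by exact: measurable_itv.
transitivity ((lebesgue_rV R n \x lebesgue_measure)%E (B `*` I)).
  rewrite /= /product_rV /pushforward; congr (product_measure1 _ _ _).
  apply/seteqP; split => -[x y] /=.
    move=> h; split => [i|].
      by have := h (lift ord_max i); rewrite !mxE liftK.
    by have := h ord_max; rewrite !mxE unlift_none /= ?in_itv.
  move=> [h1 h2] i; rewrite mxE; case: (unliftP ord_max i) => [j ->|->].
    by have := h1 j; rewrite !mxE.
  by move: h2; rewrite /I /= ?in_itv.
rewrite product_measure1E// IHn; last by move=> i; rewrite !mxE.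
rewrite big_ord_recr/= EFinM; congr (_ * _)%E.
  congr EFin; apply: eq_bigr => i _; rewrite !mxE.
  by rewrite (_ : lift _ _ = widen_ord (leqnSn n) i)//; apply/val_inj; rewrite /= /bump leqNgt ltn_ord.
rewrite [LHS]lebesgue_measure_itv/= lte_fin; case: ltP => // h; have -> : a ord0 ord_max = b ord0 ord_max by apply/le_anti; rewrite ab h.
by rewrite subrr.
Qed.

Lemma open_measurable_rV (R : realType) (n : nat) (U : set 'rV[R]_n) :
  open U -> measurable U.
Proof.
move=> oU.
pose F (p : {ffun 'I_n -> rat} * nat) : set 'rV[R]_n :=
  [set x | forall i, ball (ratr (p.1 i) : R) p.2.+1%:R^-1 (x ord0 i)].
pose G p := if `[< F p `<=` U >] then F p else set0.
have -> : U = \bigcup_p G p.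
  apply/seteqP; split => [x Ux|x [p _]]; last first.
    by rewrite /G; case: asboolP => // + Fx; apply.
  have /nbhs_ballP [e /= e0 xeU] := oU x Ux.
  have [k] := ltr_add_invr (divr_gt0 e0 (ltr0Sn R 1)); rewrite add0r => ke.
  have kp : 0 < k.+1%:R^-1 :> R by [].
  have q (i : 'I_n) : {q : rat | ball (ratr q : R) k.+1%:R^-1 (x ord0 i)}.
    apply: cid.
    have xk : x ord0 i < x ord0 i + k.+1%:R^-1 by rewrite ltrDl.
    have [q] := rat_in_itvoo xk; rewrite in_itv/= => /andP[xq qx].
    by exists q; rewrite /ball/= gtr0_norm ?subr_gt0// ltrBlDl.
  exists ([ffun i => sval (q i)], k) => //.
  rewrite /G; case: asboolP => [_ i|[]].
    by rewrite /= ffunE; exact: (svalP (q i)).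
  move=> y Fy; apply: xeU; split=> // i j; rewrite ord1.
  rewrite /ball/=; have := Fy j; have := svalP (q j); rewrite /= ffunE /ball/=.
  set r := ratr _ : R => h1 h2.
  rewrite (_ : x ord0 j - y ord0 j = (r - y ord0 j) - (r - x ord0 j)); last first.
    by rewrite opprB [RHS]addrC subrKA.
  apply: (le_lt_trans (ler_normB _ _)).
  by rewrite [ltRHS](splitr e); apply: ltrD; apply: lt_trans ke.
apply: countable_bigcupT_measurable; first exact: countableP.
move=> p; rewrite /G; case: asboolP => // _.
apply: (@measurable_box R n (fun i => ball (ratr (p.1 i) : R) p.2.+1%:R^-1)) => i.
by apply: measurable_realfun.open_measurable; exact: ball_open.
Qed.

Definition boundary (T : topologicalType) (A : set T) : set T :=
  closure A `\` interior A.

Definition bounded_domain (R : realType) (n : nat) (Omega : set 'rV[R]_n) : Prop :=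
  [/\ open Omega, connected Omega, Omega !=set0 & bounded_set Omega].

Definition partial (R : realType) (n : nat) (i : 'I_n) (u : 'rV[R]_n -> R) :
  'rV[R]_n -> R := fun x => 'D_(delta_mx ord0 i) u x.

Definition gradient (R : realType) (n : nat) (u : 'rV[R]_n -> R)
  (x : 'rV[R]_n) : 'rV[R]_n := \row_(i < n) partial i u x.

Definition hessian (R : realType) (n : nat) (u : 'rV[R]_n -> R)
  (x : 'rV[R]_n) : 'M[R]_n :=
  \matrix_(i < n, j < n) partial i (partial j u) x.

(* C^k(Omega), for Omega open: all partial derivatives of order at most k exist and
   are continuous on Omega. *)
Fixpoint Ck (R : realType) (n : nat) (k : nat) (Omega : set 'rV[R]_n)
    (u : 'rV[R]_n -> R) : Prop :=
  (forall x, Omega x -> {for x, continuous u}) /\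
  match k with
  | 0 => True
  | l.+1 => forall i : 'I_n,
      (forall x, Omega x -> derivable u x (delta_mx ord0 i)) /\
      Ck l Omega (partial i u)
  end.

(* C^1 up to the boundary: u is in C^1(Omega), and u and its first derivatives
   extend continuously to the closure of Omega. The extension of u is given by the
   values of u itself, those outside of the closure being irrelevant. *)
Definition C1_closure (R : realType) (n : nat) (Omega : set 'rV[R]_n)
    (u : 'rV[R]_n -> R) : Prop :=
  [/\ Ck 1 Omega u, {within closure Omega, continuous u} &
      forall i : 'I_n, exists2 g : 'rV[R]_n -> R,
        {within closure Omega, continuous g} & {in Omega, partial i u =1 g}].

(* The continuous extension of the gradient from Omega to its closure. At a
   boundary point the derivatives of the total function u are meaningless,
   since they depend on its values outside of the closure. *)
Definition gradient_ext (R : realType) (n : nat) (Omega : set 'rV[R]_n)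
    (u : 'rV[R]_n -> R) (x : 'rV[R]_n) : 'rV[R]_n :=
  \row_(i < n) lim (partial i u @ within Omega (nbhs x)).

(* v is the outward unit normal to Omega at x: near x, the set Omega agrees with the
   half-space of the y such that (y - x).v < 0 up to an error o(|y - x|). This
   determines v and holds at every boundary point of a domain of class C^1,
   see outward_unit_normal_sublevel. *)
Definition outward_unit_normal (R : realType) (n : nat) (Omega : set 'rV[R]_n)
    (x v : 'rV[R]_n) : Prop :=
  enorm v = 1 /\
  forall e : R, 0 < e -> \forall y \near x,
    (dotv (y - x) v < - (e * enorm (y - x)) -> Omega y) /\
    (e * enorm (y - x) < dotv (y - x) v -> ~ Omega y).

Definition normal_derivative (R : realType) (n : nat) (Omega : set 'rV[R]_n)
    (nu : 'rV[R]_n -> 'rV[R]_n) (u : 'rV[R]_n -> R) (x : 'rV[R]_n) : R :=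
  dotv (gradient_ext Omega u x) (nu x).

Definition lower_contact_set (R : realType) (n : nat) (Omega : set 'rV[R]_n)
    (u : 'rV[R]_n -> R) : set 'rV[R]_n :=
  [set x | Omega x /\ forall y, closure Omega y ->
    u x + dotv (gradient u x) (y - x) <= u y].

Lemma dotvZr (R : realType) (n : nat) (c : R) (x y : 'rV[R]_n) :
  dotv x (c *: y) = c * dotv x y.
Proof. by rewrite /dotv mulr_sumr; apply: eq_bigr => i _; rewrite mxE mulrCA. Qed.

Lemma dotvZl (R : realType) (n : nat) (c : R) (x y : 'rV[R]_n) :
  dotv (c *: x) y = c * dotv x y.
Proof. by rewrite /dotv mulr_sumr; apply: eq_bigr => i _; rewrite mxE mulrA. Qed.

Lemma dotvv_ge0 (R : realType) (n : nat) (x : 'rV[R]_n) : 0 <= dotv x x.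
Proof. by apply: sumr_ge0 => i _; rewrite -expr2 sqr_ge0. Qed.

Lemma norm_le_enorm (R : realType) (n : nat) (x : 'rV[R]_n) : `|x| <= enorm x.
Proof.
rewrite [leLHS]mx_normrE; apply: bigmax_le => [|[i j] _ /=].
  exact: sqrtr_ge0.
rewrite -sqrtr_sqr ler_sqrt; last exact: dotvv_ge0.
rewrite ord1 /dotv (bigD1 j)//= -expr2 lerDl.
by apply: sumr_ge0 => k _; rewrite -expr2 sqr_ge0.
Qed.

Lemma enorm_gt0 (R : realType) (n : nat) (x : 'rV[R]_n) : x != 0 -> 0 < enorm x.
Proof. by move=> x0; rewrite (lt_le_trans _ (norm_le_enorm x))// normr_gt0. Qed.

Lemma diff_gradient (R : realType) (n : nat) (u : 'rV[R]_n -> R)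
    (x h : 'rV[R]_n) :
  differentiable u x -> 'd u x h = dotv h (gradient u x).
Proof.
move=> du; rewrite [in LHS](row_sum_delta h) linear_sum /dotv.
apply: eq_bigr => i _; rewrite linearZ /= !mxE /partial deriveE//.
Qed.

Lemma outward_unit_normal_sublevel (R : realType) (n : nat) (Omega : set 'rV[R]_n)
    (phi : 'rV[R]_n -> R) (x : 'rV[R]_n) :
  differentiable phi x -> phi x = 0 -> gradient phi x != 0 ->
  (\forall y \near x, Omega y <-> phi y < 0) ->
  outward_unit_normal Omega x ((enorm (gradient phi x))^-1 *: gradient phi x).
Proof.
move=> dphi phix0 g0 Ophi.
set g := gradient phi x; set c := enorm g.
have c0 : 0 < c by exact: enorm_gt0.
split.
  rewrite /enorm dotvZl dotvZr mulrA -invfM.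
  have -> : dotv g g = c * c by rewrite -expr2 sqr_sqrtr// dotvv_ge0.
  by rewrite mulVf ?sqrtr1// mulf_neq0// gt_eqF.
move=> e e0.
have ec0 : 0 < e * c by rewrite mulr_gt0.
have /eqaddoP/(_ _ (divr_gt0 ec0 (ltr0Sn R 1))) := diff_locally dphi.
rewrite [X in X -> _](near_shift x 0) => near_o.
have {}near_o : \forall y \near x,
    `|phi y - dotv (y - x) g| <= e * c / 2 * `|y - x|.
  apply: filterS near_o => y; rewrite /= sub0r !fctE /= subrK phix0 add0r.
  by rewrite diff_gradient.
near=> y; set h := y - x.
have oh : `|phi y - dotv h g| <= e * c / 2 * enorm h.
  have : `|phi y - dotv h g| <= e * c / 2 * `|h| by rewrite /h; near: y.
  by move/le_trans; apply; rewrite ler_wpM2l ?norm_le_enorm// divr_ge0// ltW.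
have Oy : Omega y <-> phi y < 0 by near: y.
have dotE : dotv h (c^-1 *: g) = dotv h g / c by rewrite dotvZr mulrC.
have eh0 : 0 <= e * c * enorm h by rewrite mulr_ge0 ?sqrtr_ge0// ltW.
rewrite dotE; move: oh; rewrite ler_distl => /andP[oh1 oh2].
split.
  rewrite ltr_pdivrMr// => lth; apply/Oy; lra.
rewrite ltr_pdivlMr// => lth /Oy; lra.
Unshelve. all: by end_near. Qed.

(* Main.v *)
Require Import Defs.
From mathcomp Require Import all_boot all_order all_algebra.
From mathcomp Require Import all_classical all_reals all_analysis.
From mathcomp Require Import perm measurable_realfun ring lra.

Set Implicit Arguments.
Unset Strict Implicit.
Unset Printing Implicit Defensive.

Import Order.TTheory GRing.Theory Num.Theory.
Import numFieldNormedType.Exports.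
Local Open Scope classical_set_scope.
Local Open Scope ring_scope.

(** Alexandrov-Bakelman-Pucci argument. Let [0 < s < inf du/dnu], and let K be
    the set of the lower contact points x with [|grad u x| <= s], the gradient
    being extended to the closure of Omega. At a boundary point of K,
    Cauchy-Schwarz would give [du/dnu <= s]; hence K is a compact subset of Omega.
    For [|p| < s] the function [u - p.y] attains its minimum over the closure of
    Omega, and not on the boundary, because it decreases when one enters Omega
    against the normal; so p = grad u x at a minimum point x, which is in K.
    Thus [eball 0 s] is covered by the image of K under the gradient, whose
    measure is at most the integral of |det D^2 u| over K, that is of |f|.

    The area inequality [|F(K)| <= int_K |det DF|] is proved by bisection: if it
    fails on a cube (up to an arbitrarily small error), it fails on smaller and
    smaller cubes around some point x, which contradicts the differentiability
    of F at x, since the linear map [DF x] multiplies volumes by [|det (DF x)|]. *)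

(** * Volume and linear maps *)

(** Uniqueness of the Lebesgue measure: [|a|] times its image under [t -> a t + b] gives each
    interval []p, q]] its length. *)
Lemma lebesgue_measure_affine (R : realType) (a b : R) (B : set (measurableTypeR R)) :
  a != 0 -> measurable B ->
  lebesgue_measure ((fun t => a * t + b) @^-1` B) =
  (`|a|^-1%:E * lebesgue_measure B)%E.
Proof.
move=> a0 mB.
have mf : measurable_fun setT (fun t : measurableTypeR R => a * t + b : measurableTypeR R).
  apply: continuous_measurable_fun => x; apply: cvgD; last exact: cvg_cst.
  by apply: cvgM; [exact: cvg_cst|exact: cvg_id].
have a0' : 0 <= `|a| by [].
pose mu := mscale (NngNum a0')
  (measure_function_pushforward__canonical__measure_function_Measure lebesgue_measure mf).
have -> : lebesgue_measure B = mu B.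
  apply: lebesgue_measure_unique => // X [[p q] /= pq <-].
  rewrite /mu /mscale /= /pushforward.
  rewrite (@lebesgue_measure_itv R `]p, q])/= lte_fin.
  have [a_gt0|a_lt0|a00] := ltgtP 0 a; last by rewrite -a00 eqxx in a0.
  - rewrite [X in lebesgue_measure X](_ : _ = `](p - b) / a, (q - b) / a]%classic).
      rewrite lebesgue_measure_itv/= lte_fin ltr_pM2r ?invr_gt0// ltrBlDr subrK.
      case: ifPn => _; last by rewrite mule0.
      by rewrite -!EFinD -EFinM gtr0_norm//; congr EFin; field.
    apply/seteqP; split=> t /=; rewrite !in_itv/= ltr_pdivrMr// ler_pdivlMr//;
      by rewrite ltrBlDr lerBrDr ![t * a]mulrC.
  (* A negative slope reverses the interval, so the closed end comes first. *)
  - rewrite [X in lebesgue_measure X](_ : _ = `[(q - b) / a, (p - b) / a[%classic).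
      rewrite lebesgue_measure_itv/= lte_fin ltr_nM2r ?invr_lt0// ltrBlDr subrK.
      case: ifPn => _; last by rewrite mule0.
      by rewrite -!EFinD -EFinM ltr0_norm//; congr EFin; field.
    apply/seteqP; split=> t /=; rewrite !in_itv/= ltr_ndivlMr// ler_ndivrMr//;
      by rewrite ltrBlDr lerBrDr ![t * a]mulrC andbC.
by rewrite /mu /mscale/= muleA -EFinM mulVf ?mul1e// normr_eq0//.
Qed.

Lemma coord_le_norm (R : realType) (n : nat) (x : 'rV[R]_n) (i : 'I_n) :
  `|x ord0 i| <= `|x|.
Proof.
by rewrite [leRHS]mx_normrE; apply: (le_bigmax _ (fun j => `|x j.1 j.2|) (ord0, i)).
Qed.

Definition box (R : realType) (n : nat) (a b : 'rV[R]_n) : set 'rV[R]_n :=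
  [set x | forall i, a ord0 i <= x ord0 i <= b ord0 i].

Lemma measurable_cbox (R : realType) (n : nat) (a b : 'rV[R]_n) :
  measurable (box a b).
Proof.
have -> : box a b = [set x | forall i, `[a ord0 i, b ord0 i]%classic (x ord0 i)].
  by apply/seteqP; split => x /= h i; have := h i; rewrite /= in_itv.
apply: (@measurable_box R n (fun i => `[a ord0 i, b ord0 i]%classic)) => i.
  exact: measurable_itv.
Qed.

Lemma lebesgue_rV_cbox (R : realType) (n : nat) (a b : 'rV[R]_n) :
  (forall i, a ord0 i <= b ord0 i) ->
  lebesgue_rV R n (box a b) = (\prod_(i < n) (b ord0 i - a ord0 i))%:E.
Proof. exact: lebesgue_rV_box. Qed.

(** It suffices that the coordinates are measurable for the sigma-algebra of the boxes, that is,
    that each half-space [y <= x_i] belongs to it. *)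
Lemma measurable_rV_gen_box (R : realType) (n : nat) :
  @measurable _ 'rV[R]_n = <<s range (fun p : 'rV[R]_n * 'rV[R]_n => box p.1 p.2) >>.
Proof.
apply/seteqP; split; last first.
  apply: smallest_sub; first exact: sigma_algebra_measurable.
  by move=> _ [p _ <-]; exact: measurable_cbox.
move=> A mA.
pose G := range (fun p : 'rV[R]_n * 'rV[R]_n => box p.1 p.2).
suff H : measurable_fun setT (id : g_sigma_algebraType G -> 'rV[R]_n).
  by have := H measurableT A mA; rewrite setTI.
apply: measurable_fun_rV => i.
apply: (measurability _ (RGenCInfty.measurableE R)).
move=> _ [_ [y ->] <-]; rewrite setTI.
(* The box of index [k] is [[y, k]] in direction [i] and [[-k, k]] in the others. *)
rewrite [X in measurable X](_ : _ = \bigcup_k box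
   (\row_j if j == i then y else - k%:R) (const_mx k%:R : 'rV[R]_n)).
  apply: bigcup_measurable => k _.
  apply: sub_sigma_algebra; by eexists (_, _).
apply/seteqP; split=> [x /=|x [k _ /= h]]; rewrite in_itv/= andbT.
  move=> yx.
  exists (Num.bound `|x|) => //= j.
  have xk : `|x ord0 j| <= (Num.bound `|x|)%:R.
    by apply: le_trans (ltW (archi_boundP (normr_ge0 _))); exact: coord_le_norm.
  move: xk; rewrite ler_norml => /andP[h1 h2].
  by rewrite !mxE h2 andbT; case: ifPn => [/eqP ->|_].
by have := h i; rewrite !mxE eqxx => /andP[].
Qed.

(** Boxes generate the sigma-algebra and are stable under intersection; the cubes [[-k, k]^n] have
    finite measure and exhaust the space. *)
Lemma lebesgue_rV_unique (R : realType) (n : nat)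
    (mu : {measure set 'rV[R]_n -> \bar R}) :
  (forall a b : 'rV[R]_n, (forall i, a ord0 i <= b ord0 i) ->
    mu (box a b) = (\prod_(i < n) (b ord0 i - a ord0 i))%:E) ->
  forall A, measurable A -> lebesgue_rV R n A = mu A.
Proof.
move=> muE.
apply: (measure_unique _ (fun k => box (const_mx (- k%:R)) (const_mx k%:R))
  (measurable_rV_gen_box R n)).
- move=> _ _ [[a b] _ <-] [[c d] _ <-] /=.
  exists (\row_i Num.max (a ord0 i) (c ord0 i), \row_i Num.min (b ord0 i) (d ord0 i)) => //=.
  apply/seteqP; split => [x h|x [h1 h2] i].
    by split => i; have := h i; rewrite !mxE ge_max le_min => /andP[/andP[? ?] /andP[? ?]]; apply/andP.
  have := h1 i; have := h2 i; rewrite !mxE ge_max le_min.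
  by move=> /andP[-> ->] /andP[-> ->].
- by move=> k; exists (const_mx (- k%:R), const_mx k%:R).
- apply/seteqP; split=> [//|x _].
  exists (Num.bound `|x|) => //= i; rewrite !mxE.
  rewrite -ler_norml; apply: le_trans (ltW (archi_boundP (normr_ge0 _))).
  exact: coord_le_norm.
- move=> _ [[a b] _ <-] /=.
  have [ab|] := pselect (forall i, a ord0 i <= b ord0 i).
    by rewrite lebesgue_rV_cbox// muE.
  move=> /existsNP[i abi].
  have -> : box a b = set0.
    apply/seteqP; split=> // x /(_ i) /andP[h1 h2]; apply: abi.
    exact: le_trans h2.
  by rewrite !measure0.
- move=> k; rewrite lebesgue_rV_cbox ?ltry// => i; rewrite !mxE.
  by apply: (@le_trans _ _ 0); rewrite ?oppr_le0 ?ler0n.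
Qed.

Lemma measurable_fun_mulmx (R : realType) (m n : nat) (A : 'M[R]_(m, n)) :
  measurable_fun setT (fun x : 'rV[R]_m => x *m A).
Proof.
apply: measurable_fun_rV => i.
rewrite [X in measurable_fun _ X](_ : _ = (fun t : 'rV[R]_m => \sum_(j < m) A j i * t ord0 j)).
  apply: measurable_sum => j.
  apply: measurable_funM; first exact: measurable_cst.
  exact: measurable_coord.
by apply/funext => x; rewrite mxE; apply: eq_bigr => j _; rewrite mulrC.
Qed.

Lemma measurable_fun_addv (R : realType) (n : nat) (c : 'rV[R]_n) :
  measurable_fun setT (fun x : 'rV[R]_n => x + c).
Proof.
apply: measurable_fun_rV => i.
rewrite [X in measurable_fun _ X](_ : _ = (fun t : 'rV[R]_n => t ord0 i + c ord0 i)).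
  apply: measurable_funD; last exact: measurable_cst.
  exact: measurable_coord.
by apply/funext => x; rewrite mxE.
Qed.

Lemma lebesgue_rV_translate (R : realType) (n : nat) (c : 'rV[R]_n) A :
  measurable A ->
  lebesgue_rV R n ((fun x => x + c) @^-1` A) = lebesgue_rV R n A.
Proof.
move=> mA.
pose mu := measure_function_pushforward__canonical__measure_function_Measure
  (lebesgue_rV R n) (measurable_fun_addv c).
rewrite [RHS](@lebesgue_rV_unique _ _ mu)// => a b ab.
rewrite /mu /= /pushforward.
rewrite [X in lebesgue_rV R n X](_ : _ = box (a - c) (b - c)).
  rewrite lebesgue_rV_cbox => [|i]; last by rewrite !mxE lerB.
  by congr EFin; apply: eq_bigr => i _; rewrite !mxE; ring.
by apply/seteqP; split=> x /= h i; have := h i; rewrite !mxE lerBlDr lerBrDr.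
Qed.

(* Since points are row vectors, the linear map of matrix A is [x |-> x *m A]. *)
Definition mx_scales (R : realType) (n : nat) (A : 'M[R]_n) : Prop :=
  forall S, measurable S ->
  lebesgue_rV R n ((fun x => x *m A) @^-1` S) =
  (`|\det A|^-1%:E * lebesgue_rV R n S)%E.

Lemma mx_scalesM (R : realType) (n : nat) (A B : 'M[R]_n) :
  mx_scales A -> mx_scales B -> mx_scales (A *m B).
Proof.
move=> hA hB S mS.
rewrite (_ : _ @^-1` _ = (fun x => x *m A) @^-1` ((fun x => x *m B) @^-1` S)); last first.
  by apply/funext => x /=; rewrite mulmxA.
rewrite hA; last by have := measurable_fun_mulmx B measurableT mS; rewrite setTI.
by rewrite hB// muleA -EFinM det_mulmx normrM invfM.
Qed.

(** A permutation of the coordinates pulls a box back to a box with permuted sides, and boxes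
    determine the measure. *)
Lemma mx_scales_perm (R : realType) (n : nat) (s : 'S_n) :
  mx_scales (perm_mx s : 'M[R]_n).
Proof.
move=> A mA.
rewrite det_perm normrX normrN1 expr1n invr1 mul1e.
pose mu := measure_function_pushforward__canonical__measure_function_Measure
  (lebesgue_rV R n) (measurable_fun_mulmx (perm_mx s : 'M[R]_n)).
rewrite [RHS](@lebesgue_rV_unique _ _ mu)// => a b ab.
have pE (x : 'rV[R]_n) i : (x *m perm_mx s) ord0 i = x ord0 ((s^-1)%g i).
  by rewrite -[s in LHS]invgK -col_permE mxE.
rewrite /mu /= /pushforward.
rewrite [X in lebesgue_rV R n X](_ : _ = box (\row_i a ord0 (s i)) (\row_i b ord0 (s i))).
  rewrite lebesgue_rV_cbox => [|i]; last by rewrite !mxE.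
  congr EFin; rewrite [RHS](reindex_inj (@perm_inj _ s)).
  by apply: eq_bigr => i _; rewrite !mxE.
apply/seteqP; split=> x /= h i.
  by have := h (s i); rewrite pE permK !mxE.
by have := h ((s^-1)%g i); rewrite pE !mxE permKV.
Qed.

(* The map changes the last coordinate only, by an affine map when the other
   coordinates are fixed: Fubini. *)
Lemma mx_scales_last_col (R : realType) (n : nat) (C : 'M[R]_n.+1) :
  (forall i j, j != ord_max -> C i j = (i == j)%:R) -> C ord_max ord_max != 0 ->
  \det C = C ord_max ord_max /\ mx_scales C.
Proof.
move=> CE a0.
set a := C ord_max ord_max in a0 *.
have detC : \det C = a.
  rewrite -det_tr det_trig.
    rewrite big_ord_recr/= big1 ?mul1r ?mxE// => i _.
    by rewrite mxE CE ?eqxx// -val_eqE/= neq_ltn ltn_ord.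
  apply/is_trig_mxP => i j ij; have im : i != ord_max by rewrite -val_eqE/= neq_ltn (leq_trans ij)// -ltnS.
  by rewrite mxE CE// -val_eqE/= gtn_eqF.
split=> // S mS; rewrite detC.
(* When the first coordinates [x] are fixed, the last one is mapped by [t -> a * t + l x]. *)
pose l (x : 'rV[R]_n) := \sum_(j < n) x ord0 j * C (lift ord_max j) ord_max.
have TE p : rV_append p *m C = rV_append (p.1, a * p.2 + l p.1) :> 'rV[R]_n.+1.
  apply/rowP => i; rewrite !mxE.
  case: (unliftP ord_max i) => [j ->|->].
    rewrite (bigD1 (lift ord_max j))//= big1 ?addr0 => [|k kj].
      by rewrite mxE liftK CE ?eqxx ?mulr1// eq_sym neq_lift.
    by rewrite CE ?(negbTE kj) ?mulr0// eq_sym neq_lift.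
  rewrite big_ord_recr/= addrC mxE unlift_none/= mulrC; congr (_ + _).
  apply: eq_bigr => j _.
  rewrite (_ : widen_ord _ j = lift ord_max j); last first.
    by apply/val_inj; rewrite /= /bump leqNgt ltn_ord.
  by rewrite mxE liftK.
have mX : measurable (@rV_append R n @^-1` S).
  by rewrite -[X in measurable X]setTI; exact: measurable_rV_append.
rewrite /= /product_rV /pushforward /product_measure1.
transitivity (\int[lebesgue_rV R n]_x (`|a|^-1%:E *
   lebesgue_measure (xsection (@rV_append R n @^-1` S) x))%E)%E.
  apply: eq_integral => x _ /=.
  rewrite -(@lebesgue_measure_affine _ _ (l x))//; last exact: measurable_xsection.
  congr (lebesgue_measure _); apply/seteqP.
  by split=> t; rewrite /= /xsection/= => /set_mem h; apply/mem_set; move: h; rewrite /= TE.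
rewrite ge0_integralZl ?lee_fin ?invr_ge0//.
exact: measurable_fun_xsection.
Qed.

(** Conjugation by the transposition of [k] and the last index reduces this to
    [mx_scales_last_col]. *)
Lemma mx_scales_col (R : realType) (n : nat) (C : 'M[R]_n) (k : 'I_n) :
  (forall i j, j != k -> C i j = (i == j)%:R) -> C k k != 0 ->
  \det C = C k k /\ mx_scales C.
Proof.
case: n => [|n] in C k *; first by case: k.
move=> CE ck.
pose P : 'M[R]_n.+1 := tperm_mx k ord_max.
have PP : P *m P = 1%:M by rewrite /P -perm_mxM tperm2 perm_mx1.
pose D := P *m C *m P.
have DE i j : D i j = C (tperm k ord_max i) (tperm k ord_max j).
  by rewrite /D /P -xcolE -xrowE !mxE.
have [] := @mx_scales_last_col R n D.
- move=> i j jm; rewrite DE CE ?(inj_eq perm_inj)//.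
  by rewrite -(inj_eq (@perm_inj _ (tperm k ord_max))) tpermK tpermL.
- by rewrite DE tpermR.
rewrite DE tpermR => detD sD.
have CD : C = P *m D *m P by rewrite /D !mulmxA PP mul1mx -mulmxA PP mulmx1.
split; last first.
  have sP : mx_scales P by exact: mx_scales_perm.
  by rewrite CD; exact: mx_scalesM (mx_scalesM sP sD) sP.
rewrite -detD /D !det_mulmx mulrAC -det_mulmx PP det1 mul1r//.
Qed.

(* As in the Steinitz exchange lemma, the identity matrix is turned into A one
   column at a time; each step multiplies by a transposition and by a matrix that
   differs from the identity in one column only. *)
Lemma mx_scales_unit (R : realType) (n : nat) (A : 'M[R]_n) :
  A \in unitmx -> mx_scales A.
Proof.
move=> uA.
suff [M [sM _ MA]] : exists M, [/\ mx_scales M, M \in unitmx &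
    forall i j : 'I_n, (j < n)%N -> M i j = A i j].
  by have <- : M = A by apply/matrixP => i j; exact: MA.
(* Induction on the number [k] of columns on which [M] agrees with [A]. *)
suff H k : (k <= n)%N -> exists M, [/\ mx_scales M, M \in unitmx &
    forall i j : 'I_n, (j < k)%N -> M i j = A i j] by exact: H.
elim: k => [_|k IH kn].
  exists 1%:M; split=> //; last exact: unitmx1.
  by rewrite -perm_mx1; exact: mx_scales_perm.
have [M [sM uM MA]] := IH (ltnW kn).
pose k' := Ordinal kn.
(* The coordinates of column [k] of [A] in the basis of the columns of [M]. *)
pose c := invmx M *m col k' A.
have Mc : M *m c = col k' A by rewrite mulKVmx.
(* If [c] vanished from index [k] on, column [k] of [A] would be a combination of the previous
   columns of [A], which are those of [M]; but [A] is invertible. *)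
have [j [kj cj]] : exists j : 'I_n, (k <= j)%N /\ c j ord0 != 0.
  apply/not_existsP => nj.
  have c0 (j : 'I_n) : (k <= j)%N -> c j ord0 = 0.
    by move=> kj; apply/eqP; apply/negPn/negP => cj; apply: (nj j).
  have : A *m c = A *m delta_mx k' ord0.
    rewrite -colE -Mc; apply/matrixP => i j; rewrite !mxE; apply: eq_bigr => m _.
    rewrite ord1; have [mk|/c0 ->] := ltnP m k; last by rewrite !mulr0.
    by rewrite MA.
  move/(congr1 (mulmx (invmx A))); rewrite !mulKmx// => /matrixP/(_ k' ord0).
  by rewrite c0// mxE !eqxx => /eqP; rewrite eq_sym oner_eq0.
(* [P] brings the pivot [c_j] to place [k], where [C] needs a nonzero entry. Column [k] of
   [M *m P *m C] is then [M *m c], and the columns before [k] stay the same because [k <= j]. *)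
pose P : 'M[R]_n := tperm_mx j k'.
pose C : 'M[R]_n := \matrix_(i, m) if m == k' then (P *m c) i ord0 else (i == m)%:R.
have ck : C k' k' != 0.
  by rewrite mxE eqxx /P -xrowE mxE tpermR.
have [detC sC] : \det C = C k' k' /\ mx_scales C.
  by apply: mx_scales_col => // i m mk; rewrite mxE (negbTE mk).
have PP : P *m P = 1%:M by rewrite /P -perm_mxM tperm2 perm_mx1.
exists (M *m P *m C); split.
- have sP : mx_scales P by exact: mx_scales_perm.
  exact: mx_scalesM (mx_scalesM sM sP) sC.
- rewrite !unitmx_mul uM unitmx_perm/= unitmxE detC unitfE//.
move=> i m; rewrite ltnS leq_eqVlt => /orP[/eqP mk|mk].
  have -> : m = k' by apply/val_inj.
  have -> : (M *m P *m C) i k' = (M *m P *m (P *m c)) i ord0.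
    by rewrite [LHS]mxE [RHS]mxE; apply: eq_bigr => q _; rewrite [C _ _]mxE eqxx.
  by rewrite mulmxA -[_ *m P *m P]mulmxA PP mulmx1 Mc mxE.
have mk' : m != k' by rewrite -val_eqE/= neq_ltn mk.
rewrite mxE (bigD1 m)//= [C _ _]mxE (negbTE mk') eqxx mulr1 big1 ?addr0; last first.
  by move=> q qm; rewrite [C _ _]mxE (negbTE mk') (negbTE qm) mulr0.
rewrite /P -xcolE mxE tpermD ?MA// eq_sym//.
by rewrite -val_eqE/= neq_ltn (leq_trans mk kj).
Qed.

(** Replacing column [k] of the identity by [w], with [w_k] nonzero, gives a matrix [C] under which
    the hyperplane is the preimage of a coordinate hyperplane, itself a countable union of flat
    boxes. *)
Lemma lebesgue_rV_hyperplane (R : realType) (n : nat) (w : 'cV[R]_n) :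
  w != 0 -> measurable [set x : 'rV[R]_n | x *m w = 0] /\
  lebesgue_rV R n [set x : 'rV[R]_n | x *m w = 0] = 0.
Proof.
move=> w0.
have [k wk] : exists k, w k ord0 != 0.
  apply/not_existsP => h; move: w0; apply/negP/negPn/eqP/colP => i.
  by rewrite mxE; apply/eqP/negPn/negP; exact: h.
pose C : 'M[R]_n := \matrix_(i, m) if m == k then w i ord0 else (i == m)%:R.
have [_ sC] : \det C = C k k /\ mx_scales C.
  apply: mx_scales_col; last by rewrite mxE eqxx.
  by move=> i m mk; rewrite mxE (negbTE mk).
pose H := \bigcup_N box (\row_j if j == k then 0 else - N%:R)
   (\row_j (if j == k then 0 else N%:R) : 'rV[R]_n).
have mH : measurable H by apply: bigcup_measurable => N _; exact: measurable_cbox.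
have -> : [set x | x *m w = 0] = (fun x => x *m C) @^-1` H.
  have E (x : 'rV[R]_n) : (x *m C) ord0 k = (x *m w) ord0 ord0.
    by rewrite [LHS]mxE [RHS]mxE; apply: eq_bigr => i _; rewrite [C _ _]mxE eqxx.
  apply/seteqP; split=> [x /= xw|x [N _ /(_ k)]]; last first.
    rewrite ![(\row_ _ _) _ _]mxE eqxx => h; apply/matrixP => i j; rewrite !ord1.
    by rewrite -E [RHS]mxE; apply/le_anti; rewrite andbC.
  exists (Num.bound `|x *m C|) => // j; rewrite ![(\row_ _ _) _ _]mxE.
  case: ifPn => [/eqP ->|_]; first by rewrite E xw mxE lexx.
  rewrite -ler_norml; apply: le_trans (ltW (archi_boundP (normr_ge0 _))).
  exact: coord_le_norm.
split; first by rewrite -[X in measurable X]setTI; exact: measurable_fun_mulmx.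
rewrite sC// (_ : lebesgue_rV R n H = 0) ?mule0//.
apply: measure_negligible => //; apply: negligible_bigcup => N.
apply/negligibleP; first exact: measurable_cbox.
apply: etrans (lebesgue_rV_cbox _) _ => [i|].
  by rewrite !mxE; case: ifP => // _; apply: (@le_trans _ _ 0); rewrite ?oppr_le0 ?ler0n.
by rewrite (bigD1 k)//= !mxE eqxx subrr mul0r.
Qed.

Definition unit_box (R : realType) (n : nat) : set 'rV[R]_n := box 0 (const_mx 1).

(** For [A] invertible, the image is a preimage under the inverse. For [A] singular, it lies in the
    hyperplane orthogonal to some [w] with [A *m w = 0], so it is negligible. *)
Lemma lebesgue_rV_mulmx_unit_box (R : realType) (n : nat) (A : 'M[R]_n) :
  measurable ((fun x => x *m A) @` @unit_box R n) ->
  (lebesgue_rV R n ((fun x => x *m A) @` @unit_box R n) <= `|\det A|%:E)%E.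
Proof.
move=> mI.
have [uA|nuA] := boolP (A \in unitmx).
  rewrite (_ : _ @` _ = (fun x => x *m invmx A) @^-1` @unit_box R n); last first.
    apply/seteqP; split=> [_ [x ux <-]|x /= ux]; first by rewrite /= mulmxK.
    by exists (x *m invmx A) => //; rewrite mulmxKV.
  have uV : invmx A \in unitmx by rewrite unitmx_inv.
  rewrite (mx_scales_unit uV); last exact: measurable_cbox.
  rewrite lebesgue_rV_cbox => [|i]; last by rewrite !mxE ler01.
  rewrite big1 ?mule1 => [|i _]; last by rewrite !mxE subr0.
  by rewrite det_inv normfV invrK.
have [w w0 Aw] : exists2 w : 'cV[R]_n, w != 0 & A *m w = 0.
  have : (\rank (kermx A^T) != 0)%N.
    by rewrite mxrank_ker mxrank_tr -lt0n subn_gt0 ltn_neqAle rank_leq_row andbT; move: nuA; rewrite -row_free_unit.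
  rewrite mxrank_eq0 => /rowV0Pn[v /sub_kermxP vA v0].
  exists v^T; first by rewrite trmx_eq0.
  by apply: trmx_inj; rewrite trmx_mul trmxK vA trmx0.
have [mH H0] := lebesgue_rV_hyperplane w0.
apply: (@le_trans _ _ 0%E); last by rewrite lee_fin.
rewrite -H0; apply: le_measure; [exact/mem_set|exact/mem_set|].
by move=> _ [x _ <-] /=; rewrite -mulmxA Aw mulmx0.
Qed.

Lemma lebesgue_rV_homothety (R : realType) (n : nat) (c : 'rV[R]_n) (d : R) S :
  0 < d -> measurable S ->
  lebesgue_rV R n ((fun y => d *: y + c) @^-1` S) = ((d ^- n)%:E * lebesgue_rV R n S)%E.
Proof.
move=> d0 mS.
have ud : d%:M \in @unitmx R n by rewrite unitmxE det_scalar unitrX// unitfE gt_eqF.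
rewrite -(lebesgue_rV_translate c mS).
have -> : d ^- n = `|\det (d%:M : 'M[R]_n)|^-1 by rewrite det_scalar gtr0_norm ?exprn_gt0.
rewrite -(mx_scales_unit ud); last first.
  by have := measurable_fun_addv c measurableT mS; rewrite setTI.
by congr (lebesgue_rV R n _); apply/seteqP; split=> x /=; rewrite mul_mx_scalar.
Qed.

(** * Thickenings of compact sets *)

Lemma closed_measurable_rV (R : realType) (n : nat) (A : set 'rV[R]_n) :
  closed A -> measurable A.
Proof.
move=> cA; rewrite -(setCK A); apply: measurableC.
by apply: open_measurable_rV; exact: closed_openC.
Qed.

Lemma compact_measurable_rV (R : realType) (n : nat) (A : set 'rV[R]_n) :
  compact A -> measurable A.
Proof.
move=> cA; apply: closed_measurable_rV.
by apply: compact_closed => //; exact: norm_hausdorff.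
Qed.

Lemma bounded_setP (R : realType) (V : normedModType R) (A : set V) :
  bounded_set A -> exists2 M, 0 < M & forall x, A x -> `|x| <= M.
Proof.
move=> /pinfty_ex_gt0[M M0 h]; by exists M.
Qed.

Lemma norm_cbox (R : realType) (n : nat) (x : 'rV[R]_n) (M : R) :
  `|x| <= M -> box (const_mx (- M)) (const_mx M) x.
Proof.
by move=> xM i; rewrite !mxE -ler_norml (le_trans _ xM)// coord_le_norm.
Qed.

Lemma lebesgue_rV_bounded (R : realType) (n : nat) (A : set 'rV[R]_n) (M : R) :
  0 <= M -> measurable A -> (forall x, A x -> `|x| <= M) ->
  (lebesgue_rV R n A < +oo)%E.
Proof.
move=> M0 mA AM.
apply: (@le_lt_trans _ _ (lebesgue_rV R n (box (const_mx (- M)) (const_mx M)))).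
  apply: le_measure; [exact: mem_set|apply: mem_set; exact: measurable_cbox|].
  by move=> x /AM; exact: norm_cbox.
rewrite lebesgue_rV_cbox ?ltry// => i; rewrite !mxE.
by apply: (@le_trans _ _ 0); rewrite ?oppr_le0.
Qed.

Definition thickening (R : realType) (n : nat) (A : set 'rV[R]_n) (r : R) :
  set 'rV[R]_n := [set y | exists2 x, A x & `|y - x| < r].

Lemma open_thickening (R : realType) (n : nat) (A : set 'rV[R]_n) (r : R) :
  open (thickening A r).
Proof.
rewrite (_ : thickening A r = \bigcup_(x in A) ball x r).
  by apply: bigcup_open => x _; exact: ball_open.
apply/seteqP; split=> y [x Ax h]; exists x => //.
  by rewrite -ball_normE /ball_/= distrC.
by move: h; rewrite -ball_normE /ball_/= distrC.
Qed.

(** The thickenings of radius [1/(k+1)] have finite measure and decrease to the closed set [A], so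
    their measures tend to that of [A]. *)
Lemma lebesgue_rV_thickening (R : realType) (n : nat) (A : set 'rV[R]_n) (e : R) :
  compact A -> 0 < e -> exists2 r, 0 < r &
  (lebesgue_rV R n (thickening A r) <= lebesgue_rV R n A + e%:E)%E.
Proof.
move=> cA e0.
have clA : closed A by apply: compact_closed => //; exact: norm_hausdorff.
have [M M0 AM] := bounded_setP (compact_bounded cA).
have mA := compact_measurable_rV cA.
have Afin := lebesgue_rV_bounded (ltW M0) mA AM.
pose F k := thickening A k.+1%:R^-1.
have mF k : measurable (F k) by apply: open_measurable_rV; exact: open_thickening.
have FA : \bigcap_k F k = A.
  apply/seteqP; split=> [y Fy|y Ay k _]; last first.
    by exists y => //; rewrite subrr normr0.
  have -> : A = closure A by apply/closure_id.
  move=> B /nbhs_ballP[d /= d0 dB].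
  have [k] := ltr_add_invr d0; rewrite add0r => kd.
  have [x Ax xy] := Fy k I.
  exists x; split => //; apply: dB; rewrite -ball_normE /=.
  exact: lt_trans kd.
have := @nonincreasing_cvg_mu _ _ _ (lebesgue_rV R n) F.
rewrite FA => /(_ _ mF mA) H.
(* If no radius worked, the limit of these measures would be at least [|A| + e], while it is [|A|],
   which is finite. *)
apply: contrapT => /forall2NP nr.
have : (lebesgue_rV R n A + e%:E <= lebesgue_rV R n A)%E.
  apply: (cvge_ge _ (H _ _)).
  - near=> k.
    have [|/negP] := nr k.+1%:R^-1; first by rewrite invr_gt0 ltr0n.
    by rewrite -ltNge => /ltW.
  - apply: (@lebesgue_rV_bounded _ _ _ (M + 1)) => //; first by rewrite addr_ge0 ?ltW.
    move=> y [x /AM xM]; rewrite invr1 => /ltW yx.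
    by rewrite -(subrK x y) addrC (le_trans (ler_normD _ _))// lerD.
  - move=> k m km; apply/subsetPset => y [x Ax yx]; exists x => //.
    by rewrite (lt_le_trans yx)// lef_pV2 ?posrE ?ltr0n// ler_nat ltnS.
have fA : lebesgue_rV R n A \is a fin_num by rewrite ge0_fin_numE.
by rewrite -[leRHS]adde0 leeD2lE// lee_fin leNgt e0.
Unshelve. all: by end_near. Qed.

(** * First-order expansion of functions of class C^1 *)

Lemma norm_rV_le (R : realType) (n : nat) (x : 'rV[R]_n) (c : R) :
  0 <= c -> (forall i, `|x ord0 i| <= c) -> `|x| <= c.
Proof.
move=> c0 h; rewrite [leLHS]mx_normrE; apply: bigmax_le => // -[i j] _ /=.
by rewrite ord1.
Qed.

Lemma is_derive_line (R : realType) (V : normedModType R) (g : V -> R) (z v : V) (t : R) :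
  derivable g (z + t *: v) v ->
  is_derive t 1 (fun s : R => g (z + s *: v)) ('D_v g (z + t *: v)).
Proof.
have E : (fun h : R => h^-1 *: ((g \o shift (z + t *: v)) (h *: v) - g (z + t *: v))) =
    (fun h : R => h^-1 *: (((fun s : R => g (z + s *: v)) \o shift t) (h *: 1) - g (z + t *: v))).
  apply/funext => h /=; congr (_ *: (g _ - _)).
  by rewrite [h *: 1]mulr1 scalerDl addrCA.
move=> dg; apply: DeriveDef; first by rewrite /derivable -E.
by rewrite /derive -E.
Qed.

(** Stated with absolute values because the increment [s] may have either sign. *)
Lemma MVT_line (R : realType) (V : normedModType R) (g : V -> R) (z v : V) (s : R) :
  (forall t : R, `|t| <= `|s| -> derivable g (z + t *: v) v) ->
  exists2 t, `|t| <= `|s| & g (z + s *: v) - g z = 'D_v g (z + t *: v) * s.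
Proof.
move=> dg.
have cg (t : R) : `|t| <= `|s| -> {for t, continuous (fun s : R => g (z + s *: v))}.
  move=> ts; apply: differentiable_continuous; apply/derivable1_diffP.
  by have [] := is_derive_line (dg t ts).
have [s0|s0] := leP 0 s.
  have [||t] := @MVT_segment R (fun s : R => g (z + s *: v)) (fun t : R => 'D_v g (z + t *: v)) 0 s s0.
  - move=> t; rewrite in_itv/= => /andP[t0 ts]; apply: is_derive_line; apply: dg.
    by rewrite (ger0_norm s0) (ger0_norm (ltW t0)) ltW.
  - apply: continuous_in_subspaceT => t /set_mem; rewrite /= in_itv/= => /andP[t0 ts].
    by apply: cg; rewrite !ger0_norm.
  rewrite in_itv/= => /andP[t0 ts] E.
  exists t; first by rewrite !ger0_norm.
  by move: E; rewrite scale0r addr0 subr0.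
have [||t] := @MVT_segment R (fun s : R => g (z + s *: v)) (fun t : R => 'D_v g (z + t *: v)) s 0 (ltW s0).
- move=> t; rewrite in_itv/= => /andP[t0 ts]; apply: is_derive_line; apply: dg.
  by rewrite (ltr0_norm s0) (ltr0_norm ts) lerN2 ltW.
- apply: continuous_in_subspaceT => t /set_mem; rewrite /= in_itv/= => /andP[t0 ts].
  by apply: cg; rewrite (ltr0_norm s0) (ler0_norm ts) lerN2.
rewrite in_itv/= => /andP[t0 ts] E.
exists t; first by rewrite (ltr0_norm s0) (ler0_norm ts) lerN2.
by apply: oppr_inj; rewrite opprB -mulrN -[- s]sub0r -E scale0r addr0.
Qed.

(** One goes from [x] to [y] by changing one coordinate at a time; the mean value theorem applies on
    each segment, and the partial derivatives there are close to those at [x]. *)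
Lemma Ck1_expansion (R : realType) (n : nat) (Omega : set 'rV[R]_n)
    (g : 'rV[R]_n -> R) (x : 'rV[R]_n) :
  open Omega -> Ck 1 Omega g -> Omega x -> forall e, 0 < e ->
  \forall y \near x, `|g y - g x - dotv (y - x) (gradient g x)| <= e * `|y - x|.
Proof.
move=> oO [_ gC] Ox e e0.
(* Each of the [n] segments costs at most [e' * |y - x|]; the divisor [n + 1] is nonzero even for
   [n = 0]. *)
pose e' := e / n.+1%:R.
have e'0 : 0 < e' by rewrite divr_gt0.
have /nbhs_ballP[r /= r0 rP] : \forall y \near x,
    Omega y /\ forall i, `|partial i g y - partial i g x| < e'.
  apply: filterI; first exact: oO.
  apply: (@filter_forall _ _ (fun i y => `|partial i g y - partial i g x| < e') (nbhs x) _) => i.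
  have [_ [ci _]] := gC i.
  have /cvgrPdist_lt/(_ _ e'0) := ci _ Ox.
  by apply: filterS => y; rewrite distrC.
apply/nbhs_ballP; exists r => //= y; rewrite -ball_normE/= => yr.
pose d := y - x.
(* The vertices of the path, from [z 0 = x] to [z n = y]. *)
pose z k : 'rV[R]_n := \row_j if (j < k)%N then y ord0 j else x ord0 j.
have zn : z n = y by apply/rowP => j; rewrite mxE ltn_ord.
have z0 : z 0%N = x by apply/rowP => j; rewrite mxE ltn0.
have zS (k : 'I_n) : z k.+1 = z k + d ord0 k *: delta_mx ord0 k.
  apply/rowP => j; rewrite !mxE !eqxx/= ltnS leq_eqVlt.
  have -> : (val j == val k) = (j == k) by [].
  case: eqVneq => [->|_] /=; last by rewrite mulr0 addr0.
  by rewrite ltnn mulr1 addrC subrK.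
have step (k : 'I_n) :
    `|g (z k.+1) - g (z k) - d ord0 k * partial k g x| <= e' * `|d|.
  (* In the sup norm, no point of the segment is farther from [x] than [y] is. *)
  have zb t : `|t| <= `|d ord0 k| ->
      Omega (z k + t *: delta_mx ord0 k) /\
      `|partial k g (z k + t *: delta_mx ord0 k) - partial k g x| < e'.
    move=> td.
    suff /rP[? h] : ball x r (z k + t *: delta_mx ord0 k) by split=> //; exact: h.
    rewrite -ball_normE/=; apply: le_lt_trans yr.
    apply: norm_rV_le => // j; rewrite -[leRHS]normrN opprB.
    apply: le_trans (coord_le_norm _ j).
    rewrite !mxE !eqxx/=; case: eqVneq => [->|jk] /=.
      by rewrite ltnn mulr1 opprD addNKr normrN; move: td; rewrite !mxE.
    rewrite mulr0 addr0; case: ifP => _; first by rewrite distrC.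
    by rewrite subrr normr0.
  rewrite zS.
  have [t td ->] := @MVT_line R _ g (z k) (delta_mx ord0 k) (d ord0 k)
    (fun t td => (gC k).1 _ (zb t td).1).
  rewrite -[d ord0 k * _]mulrC -mulrBl normrM.
  by rewrite ler_pM// ?coord_le_norm// ltW// (zb t td).2.
have -> : g y - g x - dotv (y - x) (gradient g x) =
    \sum_(k < n) (g (z k.+1) - g (z k) - d ord0 k * partial k g x).
  rewrite sumrB -(big_mkord xpredT (fun k => g (z k.+1) - g (z k))) telescope_sumr// zn z0.
  by congr (_ - _); apply: eq_bigr => k _; rewrite [gradient _ _ _ _]mxE.
apply: (le_trans (ler_norm_sum _ _ _)).
apply: (@le_trans _ _ (\sum_(k < n) (e' * `|d|))); first by apply: ler_sum => k _; exact: step.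
rewrite sumr_const card_ord -mulrnAl ler_wpM2r// /e' -mulr_natr mulrAC ler_pdivrMr//.
by rewrite ler_wpM2l// ?ler_nat// ltW.
Qed.

(** * Bisection of cubes *)

Definition cube (R : realType) (n : nat) (a : 'rV[R]_n) (d : R) : set 'rV[R]_n :=
  box a (a + const_mx d).

Lemma lebesgue_rV_cube (R : realType) (n : nat) (a : 'rV[R]_n) (d : R) :
  0 <= d -> lebesgue_rV R n (cube a d) = (d ^+ n)%:E.
Proof.
move=> d0; rewrite lebesgue_rV_cbox => [|i]; last by rewrite !mxE lerDl.
rewrite (eq_bigr (fun=> d)) => [|i _]; last by rewrite !mxE addrAC subrr add0r.
by rewrite prodr_const card_ord.
Qed.

Lemma cube_dist (R : realType) (n : nat) (a : 'rV[R]_n) (d : R) x y :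
  0 <= d -> cube a d x -> cube a d y -> `|y - x| <= d.
Proof.
move=> d0 ax ay; apply: norm_rV_le => // i.
have := ax i; have := ay i; rewrite !mxE ler_norml => /andP[? ?] /andP[? ?].
by apply/andP; split; lra.
Qed.

Definition upd (R : realType) (n : nat) (a : 'rV[R]_n) (i : 'I_n) (c : R) : 'rV[R]_n :=
  \row_j if j == i then c else a ord0 j.

(** Used by contraposition: if [P] fails on a box, it fails on one of the two parts cut by the
    hyperplane [x_i = c]. *)
Definition box_mergeable (R : realType) (n : nat) (P : set 'rV[R]_n -> Prop) :=
  forall (a b : 'rV[R]_n) i c, a ord0 i <= c <= b ord0 i ->
  P (box a (upd b i c)) -> P (box (upd a i c) b) -> P (box a b).

(** The cube is cut in each direction in turn, and each time a half on which [P] fails is kept. *)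
Lemma cube_halving (R : realType) (n : nat) (P : set 'rV[R]_n -> Prop) a d :
  box_mergeable P -> 0 < d -> ~ P (cube a d) ->
  exists2 a' : 'rV[R]_n, ~ P (cube a' (d / 2)) &
  forall i, a ord0 i <= a' ord0 i /\ a' ord0 i + d / 2 <= a ord0 i + d.
Proof.
move=> mP d0 nP.
(* The side lengths after [k] cuts. *)
pose s k : 'rV[R]_n := \row_j if (j < k)%N then d / 2 else d.
have sn : s n = const_mx (d / 2) by apply/rowP => j; rewrite !mxE ltn_ord.
suff [a' nP' a'P] : exists2 a' : 'rV[R]_n, ~ P (box a' (a' + s n)) &
    forall i, a ord0 i <= a' ord0 i /\ a' ord0 i + s n ord0 i <= a ord0 i + d.
  by exists a'; [rewrite /cube -sn|move=> i; have := a'P i; rewrite sn mxE].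
suff H k : (k <= n)%N -> exists2 a' : 'rV[R]_n, ~ P (box a' (a' + s k)) &
    forall i, a ord0 i <= a' ord0 i /\ a' ord0 i + s k ord0 i <= a ord0 i + d by exact: H.
elim: k => [_|k IH kn].
  have s0 : s 0%N = const_mx d by apply/rowP => j; rewrite !mxE ltn0.
  by exists a; rewrite s0// => i; rewrite mxE.
have [a' nP' a'P] := IH (ltnW kn).
pose i := Ordinal kn.
have sS (j : 'I_n) : j != i -> s k.+1 ord0 j = s k ord0 j.
  move=> ji; rewrite !mxE ltnS leq_eqVlt.
  by have -> : (nat_of_ord j == k) = (j == i) by []; rewrite (negbTE ji).
have si : s k.+1 ord0 i = d / 2 by rewrite mxE ltnS leqnn.
have si' : s k ord0 i = d by rewrite mxE ltnn.
pose c := a' ord0 i + d / 2.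
have a'i := a'P i; rewrite si' in a'i.
have [h1|h1] := pselect (P (box a' (upd (a' + s k) i c))); last first.
  exists a'.
    suff <- : upd (a' + s k) i c = a' + s k.+1 by [].
    apply/rowP => j; rewrite [LHS]mxE [RHS]mxE; case: eqVneq => [->|ji].
      by rewrite si.
    by rewrite mxE sS.
  move=> j; have [->|ji] := eqVneq j i; last by rewrite sS//.
  by rewrite si; split; [tauto|lra].
(* [P] holds on the lower half, so it fails on the upper one. *)
have h2 : ~ P (box (upd a' i c) (a' + s k)).
  move=> h2; apply: nP'; apply: (mP _ _ i c) => //.
  by rewrite mxE si' /c; apply/andP; split; lra.
exists (upd a' i c).
  suff <- : a' + s k = upd a' i c + s k.+1 by [].
  apply/rowP => j; rewrite [LHS]mxE [RHS]mxE [upd _ _ _ _ _]mxE; case: eqVneq => [->|ji].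
    by rewrite si si' /c; lra.
  by rewrite sS.
move=> j; rewrite [upd _ _ _ _ _]mxE; have [->|ji] := eqVneq j i; last by rewrite sS//.
by rewrite si /c; split; lra.
Qed.

(** Repeated halving gives nested cubes of side [d / 2^k] on which [P] fails; [x] is their common
    point. *)
Lemma cube_bisection (R : realType) (n : nat) (P : set 'rV[R]_n -> Prop) a d :
  box_mergeable P -> 0 < d -> ~ P (cube a d) ->
  exists x, forall r, 0 < r -> exists a' d',
    [/\ 0 < d' < r, cube a' d' x & ~ P (cube a' d')].
Proof.
move=> mP d0 nP.
(* The existence is made unconditional, with [p] itself as default value, so that choice yields a
   map to iterate. *)
have step (p : 'rV[R]_n * R) : exists q : 'rV[R]_n * R, 0 < p.2 -> ~ P (cube p.1 p.2) ->
    [/\ q.2 = p.2 / 2, ~ P (cube q.1 q.2) &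
    forall i, p.1 ord0 i <= q.1 ord0 i /\ q.1 ord0 i + q.2 <= p.1 ord0 i + p.2].
  have [[p0 nPp]|h] := pselect (0 < p.2 /\ ~ P (cube p.1 p.2)).
    have [a' h1 h2] := cube_halving mP p0 nPp.
    by exists (a', p.2 / 2).
  by exists p => h1 h2; case: h.
have [f fP] := choice step.
pose p k := iter k f (a, d).
have pP k : (p k).2 = d / 2 ^+ k /\ ~ P (cube (p k).1 (p k).2).
  elim: k => [|k [IH1 IH2]]; first by rewrite expr0 divr1.
  have [|h1 h2 _] := fP (p k) _ IH2; first by rewrite IH1 divr_gt0// exprn_gt0.
  by rewrite /p iterS -/(p k); split=> //; rewrite h1 IH1 exprSr invfM mulrA.
have p2 k : 0 < (p k).2 by rewrite (pP k).1 divr_gt0// exprn_gt0.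
have pS k i : (p k).1 ord0 i <= (p k.+1).1 ord0 i /\
    (p k.+1).1 ord0 i + (p k.+1).2 <= (p k).1 ord0 i + (p k).2.
  by have [_ _] := fP (p k) (p2 k) (pP k).2; exact.
have pm k m i : (k <= m)%N -> (p k).1 ord0 i <= (p m).1 ord0 i /\
    (p m).1 ord0 i + (p m).2 <= (p k).1 ord0 i + (p k).2.
  move=> /subnK <-; elim: (m - k)%N => [|j [IH1 IH2]]; first by rewrite add0n.
  have [h1 h2] := pS (j + k)%N i; rewrite addSn.
  by split; [exact: le_trans h1|exact: le_trans IH2].
(* By nestedness, every lower corner lies below every upper corner, so the supremum of the lower
   corners belongs to all the cubes. *)
pose x : 'rV[R]_n := \row_i sup (range (fun k => (p k).1 ord0 i)).
have pub k i m : (p m).1 ord0 i <= (p k).1 ord0 i + (p k).2.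
  have [km|/ltnW mk] := leqP k m.
    by apply: le_trans (pm k m i km).2; rewrite lerDl ltW.
  by apply: le_trans (pm m k i mk).1 _; rewrite lerDl ltW.
have px k : cube (p k).1 (p k).2 x.
  move=> i; rewrite !mxE; apply/andP; split.
    apply: sup_ubound; last by exists k.
    by exists ((p 0%N).1 ord0 i + (p 0%N).2) => _ [m _ <-]; exact: pub.
  apply: ge_sup; first by exists ((p 0%N).1 ord0 i), 0%N.
  by move=> _ [m _ <-]; exact: pub.
exists x => r r0.
have [k kr] : exists k, d / 2 ^+ k < r.
  (* With [N] this bound, [d / r < N < 2^N]. *)
  exists (Num.bound (d / r)); rewrite ltr_pdivrMr ?exprn_gt0// mulrC -ltr_pdivrMr//.
  have := archi_boundP (ltW (divr_gt0 d0 r0)) => /lt_trans; apply.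
  by rewrite -natrX ltr_nat ltn_expl.
exists (p k).1, (p k).2; split=> //; last exact: (pP k).2.
by rewrite p2/= (pP k).1.
Qed.

(** * The area inequality *)

Lemma coord_cvg_rV (R : realType) (n : nat) (T : topologicalType)
    (f : T -> 'rV[R]_n) (x : T) :
  (forall i, {for x, continuous (fun y => f y ord0 i)}) -> {for x, continuous f}.
Proof.
move=> cf; apply/cvgrPdist_le => e e0.
have : \forall y \near x, forall i, `|f x ord0 i - f y ord0 i| <= e.
  apply: (@filter_forall _ _ (fun i y => `|f x ord0 i - f y ord0 i| <= e) (nbhs x) _) => i.
  by have /cvgrPdist_le/(_ _ e0) := cf i.
apply: filterS => y h; apply: norm_rV_le; first exact: ltW.
by move=> i; rewrite !mxE.
Qed.

Lemma mulmx_continuous (R : realType) (m n : nat) (A : 'M[R]_(m, n)) :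
  continuous (fun x : 'rV[R]_m => x *m A).
Proof.
move=> x; apply: coord_cvg_rV => i.
rewrite (_ : (fun y : 'rV[R]_m => (y *m A) ord0 i) =
  (fun y : 'rV[R]_m => \sum_(j < m) y ord0 j * A j i)); last first.
  by apply/funext => y; rewrite mxE.
apply: (@continuous_big _ _ +%R 0 xpredT) => [|j _ z].
  by move=> z; exact: add_continuous.
apply: continuousM; first exact: (@coord_continuous _ _ _ ord0 j z).
exact: cst_continuous.
Qed.

Lemma compact_cbox (R : realType) (n : nat) (a b : 'rV[R]_n) : compact (box a b).
Proof.
have -> : box a b = [set x | forall i, `[a ord0 i, b ord0 i]%classic (x ord0 i)].
  by apply/seteqP; split => x /= h i; have := h i; rewrite /= in_itv.
by apply: (@rV_compact _ _ (fun i => `[a ord0 i, b ord0 i]%classic)) => i; exact: segment_compact.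
Qed.

Lemma compact_mulmx_unit_box (R : realType) (n : nat) (A : 'M[R]_n) :
  compact ((fun x => x *m A) @` @unit_box R n).
Proof.
apply: continuous_compact; last exact: compact_cbox.
by apply: continuous_subspaceT; exact: mulmx_continuous.
Qed.

(** On a small cube, [F] is within [s/2 * d] of its affine approximation at [x]. After a translation
    and division by [d], the image lies in the [s]-thickening of the image of the unit box under
    [A], of volume at most [|det A| + e]. *)
Lemma cube_image_measure (R : realType) (n : nat) (F : 'rV[R]_n -> 'rV[R]_n)
    (A : 'M[R]_n) (x : 'rV[R]_n) :
  (forall e : R, 0 < e -> \forall y \near x, `|F y - F x - (y - x) *m A| <= e * `|y - x|) ->
  forall e : R, 0 < e -> exists2 r, 0 < r & forall a d, 0 < d < r -> cube a d x ->
    exists S, [/\ measurable S, F @` cube a d `<=` S &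
      (lebesgue_rV R n S <= ((`|\det A| + e) * d ^+ n)%:E)%E].
Proof.
move=> dF e e0.
have [s s0 sP] := lebesgue_rV_thickening (@compact_mulmx_unit_box R n A) e0.
set T := thickening _ _ in sP.
have mT : measurable T by apply: open_measurable_rV; exact: open_thickening.
have s20 : 0 < s / 2 by rewrite divr_gt0.
have /nbhs_ballP[r /= r0 rP] := dF _ s20.
exists r => // a d /andP[d0 dr] ax.
(* The value at the corner [a] of the affine approximation of [F]. *)
pose c := F x + (a - x) *m A.
(* This set is [c + d T], written as a preimage so that [lebesgue_rV_homothety] applies. *)
exists ((fun y => d^-1 *: y + - (d^-1 *: c)) @^-1` T); split.
- have mf : measurable_fun setT (fun y : 'rV[R]_n => d^-1 *: y + - (d^-1 *: c)).
    apply: (measurableT_comp (measurable_fun_addv _)).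
    rewrite (_ : ( *:%R d^-1) = (fun y : 'rV[R]_n => y *m d^-1%:M)).
      exact: measurable_fun_mulmx.
    by apply/funext => y; rewrite mul_mx_scalar.
  by rewrite -[X in measurable X]setTI; exact: mf.
- move=> _ [y ay <-] /=.
  exists (d^-1 *: (y - a) *m A).
    exists (d^-1 *: (y - a)) => // i.
    have := ay i; rewrite !mxE mulrC => /andP[h1 h2].
    by rewrite divr_ge0 ?subr_ge0 ?(ltW d0)//= ler_pdivrMr// mul1r lerBlDl.
  rewrite -scalemxAl -scalerBr -scalerBr normrZ gtr0_norm ?invr_gt0// mulrC ltr_pdivrMr//.
  rewrite (_ : _ - _ = F y - F x - (y - x) *m A); last first.
    rewrite /c opprD -!addrA; congr (_ + (_ + _)).
    by rewrite -opprD -mulmxDl [_ + (y - a)]addrC subrKA.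
  apply: (@le_lt_trans _ _ (s / 2 * `|y - x|)).
    by apply: rP; rewrite -ball_normE/= distrC (le_lt_trans _ dr)// (cube_dist (ltW d0) ax ay).
  apply: (@le_lt_trans _ _ (s / 2 * d)).
    by rewrite ler_wpM2l ?(ltW s20)// (cube_dist (ltW d0) ax ay).
  by rewrite ltr_pM2r//; lra.
- rewrite lebesgue_rV_homothety ?invr_gt0// exprVn invrK mulrC EFinM.
  rewrite lee_pmul2l ?lte_fin ?exprn_gt0//.
  apply: (le_trans sP); rewrite EFinD leeD2r//.
  apply: lebesgue_rV_mulmx_unit_box; apply: compact_measurable_rV.
  exact: compact_mulmx_unit_box.
Qed.

Lemma measurable_fun_within (R : realType) (n : nat) (D : set 'rV[R]_n)
    (f : 'rV[R]_n -> R) :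
  {within D, continuous f} -> measurable_fun D (f : 'rV[R]_n -> measurableTypeR R).
Proof.
move=> /continuousP cf mD.
apply: (measurability _ (RGenOpens.measurableE R) _ mD).
move=> _ [_ [a [b ->] <-]].
have : open ((f : subspace D -> R) @^-1` `]a, b[) by exact/cf/interval_open.
move=> /open_subspaceP[V oV VE].
rewrite setIC -VE.
by apply: measurableI; [exact: open_measurable_rV|exact: mD].
Qed.

Lemma updE (R : realType) (n : nat) (a : 'rV[R]_n) i c j :
  upd a i c ord0 j = if j == i then c else a ord0 j.
Proof. exact: mxE. Qed.

Lemma lebesgue_rV_flat_box (R : realType) (n : nat) (a b : 'rV[R]_n) i :
  a ord0 i = b ord0 i -> lebesgue_rV R n (box a b) = 0%E.
Proof.
move=> abi; have [ab|] := pselect (forall i, a ord0 i <= b ord0 i).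
  by rewrite lebesgue_rV_cbox// (bigD1 i)//= abi subrr mul0r.
move=> /existsNP[j abj].
have -> : box a b = set0.
  by apply/seteqP; split=> // x /(_ j) /andP[h1 h2]; apply: abj; exact: le_trans h2.
exact: measure0.
Qed.

(** The measure of the image is subadditive, and the integral is additive because the two parts of
    the box share only a face, which is negligible. *)
Lemma image_measure_mergeable (R : realType) (n : nat) (F : 'rV[R]_n -> 'rV[R]_n)
    (K : set 'rV[R]_n) (w : 'rV[R]_n -> \bar R) :
  compact K -> {within K, continuous F} -> measurable_fun setT w ->
  (forall x, (0 <= w x)%E) ->
  box_mergeable (fun Q => (lebesgue_rV R n (F @` (Q `&` K)) <=
    \int[lebesgue_rV R n]_(x in Q) w x)%E).
Proof.
move=> cK cF mw w0 a b i c /andP[ac cb].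
set B1 := box a (upd b i c); set B2 := box (upd a i c) b.
(* The common face, in the hyperplane [x_i = c]. *)
pose N := box (upd a i c) (upd b i c).
have mwD D : measurable_fun D w by exact: measurable_funTS.
have mB1 : measurable B1 by exact: measurable_cbox.
have mB2 : measurable B2 by exact: measurable_cbox.
have mN : measurable N by exact: measurable_cbox.
have N0 : lebesgue_rV R n N = 0%E.
  by apply: (@lebesgue_rV_flat_box _ _ _ _ i); rewrite !updE eqxx.
have BE : box a b = B1 `|` B2.
  apply/seteqP; split=> [x abx|x [xB|xB] j].
  - have [xc|/ltW cx] := leP (x ord0 i) c; [left|right] => j; have := abx j;
      by rewrite updE; case: eqVneq => // -> /andP[h1 h2]; rewrite ?h1 ?h2 ?andbT.
  - have := xB j; rewrite updE; case: eqVneq => // -> /andP[-> /le_trans]; exact.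
  - have := xB j; rewrite updE; case: eqVneq => // -> /andP[h1 ->].
    by rewrite (le_trans ac h1).
have B2N : B2 `\` N = B2 `\` B1.
  apply/seteqP; split=> x [xB xN]; split=> // xh; apply: xN => j.
  - have := xh j; have := xB j; rewrite !updE.
    by case: eqVneq => // _ /andP[-> _] /andP[_ ->].
  - have := xh j; have := xB j; rewrite !updE.
    case: eqVneq => // -> /andP[h1 h2] /andP[h3 h4].
    by rewrite h4 (le_trans ac).
(* These images are compact, hence measurable. *)
have mF a' b' : measurable (F @` (box a' b' `&` K)).
  apply: compact_measurable_rV; apply: continuous_compact.
    by apply: continuous_subspaceW cF => x [].
  rewrite setIC; apply: compact_closedI => //.
  by apply: compact_closed; [exact: norm_hausdorff|exact: compact_cbox].
move=> P1 P2.
rewrite BE setIUl image_setU.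
have := @measureU2 _ _ _ (lebesgue_rV R n) _ _ (mF a (upd b i c)) (mF (upd a i c) b).
move=> /le_trans; apply.
apply: (le_trans (leeD P1 P2)).
rewrite [X in (_ + X)%E](ge0_negligible_integral mN)// B2N -ge0_integral_setU//.
- apply: ge0_subset_integral => //; [exact/measurableU/measurableD|exact: measurableU|].
  by move=> x [|[]]; [left|right].
- exact: measurableD.
- by apply/disj_setPS => x [h [_]].
Qed.

(** The bisection is applied to a weight [w] on a cube containing [K], whose integral exceeds that
    of [|det DF|] over [K] by at most an arbitrary [e']. *)
Lemma area_le (R : realType) (n : nat) (F : 'rV[R]_n -> 'rV[R]_n)
    (DF : 'rV[R]_n -> 'M[R]_n) (K : set 'rV[R]_n) :
  compact K -> {within K, continuous F} ->
  {within K, continuous (fun x => `|\det (DF x)|)} ->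
  (forall x, K x -> forall e : R, 0 < e ->
    \forall y \near x, `|F y - F x - (y - x) *m DF x| <= e * `|y - x|) ->
  (lebesgue_rV R n (F @` K) <= \int[lebesgue_rV R n]_(x in K) `|\det (DF x)|%:E)%E.
Proof.
move=> cK cF cD dF.
set h := fun x => `|\det (DF x)|.
have [->|/set0P K0] := eqVneq K set0.
  by rewrite image_set0 measure0 integral_set0.
have clK : closed K by apply: compact_closed => //; exact: norm_hausdorff.
have mK : measurable K by exact: compact_measurable_rV.
have [c _ hC] := compact_EVT_max K0 cK cD.
set C := `|\det (DF c)| in hC.
have C0 : 0 <= C by rewrite normr_ge0.
have {}hC x : K x -> h x <= C by move=> Kx; apply: hC; exact/mem_set.
have [M M0 KM] := bounded_setP (compact_bounded cK).
have Kfin := lebesgue_rV_bounded (ltW M0) mK KM.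
pose a0 : 'rV[R]_n := const_mx (- M).
have d0 : 0 < M + M by rewrite addr_gt0.
have K_cube : K `<=` cube a0 (M + M).
  move=> x /KM/norm_cbox xM i; have := xM i; rewrite !mxE addKr//.
have mh : measurable_fun K (fun x => (h x)%:E).
  by apply/measurable_EFinP; exact: measurable_fun_within.
(* The excess of the weight is at most [e * C] from [U \ K], plus [e] times the volume of the cube;
   the [1] makes [L] positive. *)
pose L := C + (M + M) ^+ n + 1.
have L0 : 0 < L by rewrite ltr_wpDl// addr_ge0// exprn_ge0// ltW.
apply/lee_addgt0Pr => e' e'0.
pose e := e' / L.
have e0 : 0 < e by rewrite divr_gt0.
have [s s0 sP] := lebesgue_rV_thickening cK e0.
set U := thickening K s in sP.
have oU : open U by exact: open_thickening.
have mU : measurable U by exact: open_measurable_rV.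
have KU : K `<=` U by move=> x Kx; exists x => //; rewrite subrr normr0.
have mUK : measurable (U `\` K) by exact: measurableD.
have UKe : (lebesgue_rV R n (U `\` K) <= e%:E)%E.
  rewrite measureD//; last first.
    by apply: le_lt_trans sP _; rewrite lte_add_pinfty// ltry.
  by rewrite setIidr// leeBlDr 1?addeC// ge0_fin_numE.
(* A weight which dominates [|det DF x|] near every point x of K, with an
   excess of e, although nothing is known of [DF] outside of K. *)
pose w1 := (fun x => (h x)%:E) \_ K.
pose w2 := (cst C%:E : 'rV[R]_n -> \bar R) \_ (U `\` K).
pose w x := (w1 x + w2 x + e%:E)%E.
have w1_ge0 x : (0 <= w1 x)%E.
  by rewrite /w1 patchE; case: ifP => // _; rewrite lee_fin normr_ge0.
have w2_ge0 x : (0 <= w2 x)%E.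
  by rewrite /w2 patchE; case: ifP => // _; rewrite lee_fin.
have mw1 : measurable_fun setT w1 by apply/(measurable_restrictT _ mK).
have mw2 : measurable_fun setT w2.
  by apply/(measurable_restrictT _ mUK); exact: measurable_cst.
have mw : measurable_fun setT w.
  by apply: emeasurable_funD; [exact: emeasurable_funD|exact: measurable_cst].
have w_ge0 x : (0 <= w x)%E by rewrite !adde_ge0// lee_fin ltW.
have mwD D : measurable_fun D w by exact: measurable_funTS.
have main : (lebesgue_rV R n (F @` (cube a0 (M + M) `&` K)) <=
    \int[lebesgue_rV R n]_(x in cube a0 (M + M)) w x)%E.
  apply: contrapT => nP.
  have := cube_bisection (image_measure_mergeable cK cF mw w_ge0) d0 nP.
  move=> [x xP].
  (* If [x] is not in [K], small cubes around it miss [K] and the image is empty. *)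
  have [Kx|nKx] := pselect (K x); last first.
    have : nbhs x (~` K) by apply: open_nbhs_nbhs; split=> //; exact: closed_openC.
    move=> /nbhs_ballP[r /= r0 rP].
    have [a [d [/andP[dd0 dr] ax]]] := xP _ r0; apply.
    rewrite (_ : _ `&` K = set0) ?image_set0 ?measure0 ?integral_ge0//.
    apply/seteqP; split=> // y [ay Ky]; apply: (rP y) => //.
    by rewrite -ball_normE/= distrC (le_lt_trans _ dr)// (cube_dist (ltW dd0) ax ay).
  (* Half of [e] is for the volume of the image, half for the variation of [|det DF|] on [K] near
     [x]. *)
  have e20 : 0 < e / 2 by rewrite divr_gt0.
  have [r1 r10 r1P] := cube_image_measure (dF x Kx) e20.
  have : nbhs x U by apply: open_nbhs_nbhs; split=> //; exact: KU.
  move=> /nbhs_ballP[r2 /= r20 r2P].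
  have : nbhs (x : subspace K) [set y | `|h x - h y| < e / 2].
    by have /cvgrPdist_lt := cD x; exact.
  move=> /(nbhs_subspace_ex _ Kx)[V /nbhs_ballP[r3 /= r30 r3P] VE].
  pose r := Num.min r1 (Num.min r2 r3).
  have r0 : 0 < r by rewrite !lt_min r10 r20.
  have [a [d [/andP[dd0 +] ax]]] := xP _ r0; rewrite !lt_min => /and3P[dr1 dr2 dr3].
  apply.
  have ab y r' : d < r' -> cube a d y -> ball x r' y.
    by move=> dr ay; rewrite -ball_normE/= distrC (le_lt_trans _ dr)// (cube_dist (ltW dd0) ax ay).
  have [|S [mS FS Sle]] := r1P a d _ ax; first by rewrite dd0.
  have mcube : measurable (cube a d) by exact: measurable_cbox.
  have mFK : measurable (F @` (cube a d `&` K)).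
    apply: compact_measurable_rV; apply: continuous_compact.
      by apply: continuous_subspaceW cF => y [].
    rewrite setIC; apply: compact_closedI => //.
    by apply: compact_closed; [exact: norm_hausdorff|exact: compact_cbox].
  apply: (@le_trans _ _ (lebesgue_rV R n S)).
    apply: le_measure; [exact: mem_set|exact: mem_set|].
    by apply: subset_trans FS; apply: image_subset => y [].
  apply: (le_trans Sle).
  rewrite -/(h x) EFinM -(lebesgue_rV_cube a (ltW dd0)) -integral_cst//.
  apply: ge0_le_integral => //.
  - by move=> y _; rewrite lee_fin addr_ge0// ?normr_ge0// ltW.
  (* On the small cube, [w >= h x + e/2]: on [K] since [h y > h x - e/2], off [K] since [w = C + e]
     there and [C >= h x]. *)
  - move=> y ay; rewrite /w /w1 /w2 !patchE.
    have Uy : U y by apply: r2P; exact: ab.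
    have [Ky|nKy] := pselect (K y).
      rewrite mem_set// memNset; last by move=> [].
      rewrite adde0 -EFinD lee_fin.
      have [/= + _] : ([set y | `|h x - h y| < e / 2] `&` K) y.
        by rewrite VE; split=> //; apply: r3P; exact: ab.
      by rewrite ltr_norml => /andP[h1 h2]; lra.
    rewrite memNset// mem_set; last by split.
    rewrite add0e -EFinD lee_fin lerD//; last lra.
    exact: hC.
rewrite (setIidr K_cube) in main.
apply: (le_trans main).
set Q := cube _ _.
have mQ : measurable Q by exact: measurable_cbox.
rewrite ge0_integralD//=; last 3 first.
- by move=> x _; exact: adde_ge0.
- by apply: measurable_funTS; exact: emeasurable_funD.
- by move=> x _; rewrite lee_fin ltW.
rewrite ge0_integralD//=; last 2 first.
- exact: measurable_funTS.
- exact: measurable_funTS.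
rewrite integral_cst// (lebesgue_rV_cube a0 (ltW d0)).
rewrite -integral_mkcondr -integral_mkcondr integral_cst; last exact: measurableI.
rewrite setIidr// -addeA leeD2l//.
apply: (@le_trans _ _ (C%:E * e%:E + e%:E * ((M + M) ^+ n)%:E)%E).
  rewrite leeD2r// lee_wpmul2l// ?lee_fin//; apply: le_trans UKe.
  by apply: le_measure; [apply: mem_set; exact: measurableI|exact: mem_set|].
rewrite -!EFinM -EFinD lee_fin [C * e]mulrC -mulrDr /e.
rewrite mulrAC ler_pdivrMr// ler_wpM2l ?(ltW e'0)// /L; lra.
Qed.

(** * Lower contact points *)

Lemma cvg_dotv (R : realType) (n : nat) (T : Type) (F : set_system T)
    (FF : Filter F) (f g : T -> 'rV[R]_n) (a b : 'rV[R]_n) :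
  (forall i, f t ord0 i @[t --> F] --> a ord0 i) ->
  (forall i, g t ord0 i @[t --> F] --> b ord0 i) ->
  dotv (f t) (g t) @[t --> F] --> dotv a b.
Proof.
move=> fa gb; apply: (@cvg_big _ _ +%R 0 xpredT) => [|j _].
  by move=> z; exact: add_continuous.
by apply: cvgM; [exact: fa|exact: gb].
Qed.

Lemma dotvC (R : realType) (n : nat) (x y : 'rV[R]_n) : dotv x y = dotv y x.
Proof. by apply: eq_bigr => i _; rewrite mulrC. Qed.

Lemma dotvDl (R : realType) (n : nat) (x y z : 'rV[R]_n) :
  dotv (x + y) z = dotv x z + dotv y z.
Proof. by rewrite -big_split; apply: eq_bigr => i _; rewrite mxE mulrDl. Qed.

Lemma dotvBl (R : realType) (n : nat) (x y z : 'rV[R]_n) :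
  dotv (x - y) z = dotv x z - dotv y z.
Proof. by rewrite -scaleN1r dotvDl dotvZl mulN1r. Qed.

Lemma dotvBr (R : realType) (n : nat) (x y z : 'rV[R]_n) :
  dotv z (x - y) = dotv z x - dotv z y.
Proof. by rewrite dotvC dotvBl !(dotvC z). Qed.

Lemma dotvDr (R : realType) (n : nat) (x y z : 'rV[R]_n) :
  dotv z (x + y) = dotv z x + dotv z y.
Proof. by rewrite dotvC dotvDl !(dotvC z). Qed.

Lemma dotvv_gt0 (R : realType) (n : nat) (x : 'rV[R]_n) : x != 0 -> 0 < dotv x x.
Proof. by move=> /enorm_gt0; rewrite sqrtr_gt0. Qed.

Lemma enorm1 (R : realType) (n : nat) (v : 'rV[R]_n) : enorm v = 1 -> dotv v v = 1.
Proof. by move=> v1; rewrite -(sqr_sqrtr (dotvv_ge0 v)) -/(enorm v) v1 expr1n. Qed.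

(** Cauchy-Schwarz with a unit vector, from the nonnegative square of [x - (x.v) v]. *)
Lemma dotv_unit_le (R : realType) (n : nat) (x v : 'rV[R]_n) (s : R) :
  0 <= s -> dotv x x <= s ^+ 2 -> enorm v = 1 -> dotv x v <= s.
Proof.
move=> s0 xs v1.
have vv := enorm1 v1.
have := dotvv_ge0 (x - dotv x v *: v).
rewrite dotvBl !dotvBr !dotvZl !dotvZr vv (dotvC v) => h.
by rewrite leNgt; apply/negP => sx; nra.
Qed.

Lemma closed_le_within (R : realType) (T : topologicalType) (C : set T)
    (phi : T -> R) (c : R) :
  closed C -> {within C, continuous phi} -> closed [set x | C x /\ phi x <= c].
Proof.
move=> clC /subspace_continuousP cphi x clx.
have Cx : C x.
  by apply: clC; apply: closure_subset clx => y [].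
split=> //; rewrite leNgt; apply/negP => cx.
have : \forall y \near within C (nbhs x), c < phi y.
  by have /cvgr_gt/(_ _ cx) := cphi x Cx.
rewrite near_withinE => /clx[y [[Cy phiy] /(_ Cy)]].
by rewrite ltNge phiy.
Qed.

(** One field [g], continuous on the closure, stands for the gradient inside and for its limits at
    the boundary, so that closed conditions can be written with it. *)
Lemma gradient_extension (R : realType) (n : nat) (Omega : set 'rV[R]_n)
    (u : 'rV[R]_n -> R) :
  C1_closure Omega u -> exists g : 'rV[R]_n -> 'rV[R]_n,
  [/\ forall i, {within closure Omega, continuous (fun x => g x ord0 i)},
      forall x, Omega x -> gradient u x = g x &
      forall x, closure Omega x -> gradient_ext Omega u x = g x].
Proof.
move=> [_ _ ug].
have h i : exists g : 'rV[R]_n -> R,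
    {within closure Omega, continuous g} /\ {in Omega, partial i u =1 g}.
  by have [g] := ug i; exists g.
have [g gP] := choice h.
exists (fun x => \row_i g i x); split.
- by move=> i; under eq_fun do rewrite mxE; exact: (gP i).1.
- by move=> x Ox; apply/rowP => i; rewrite !mxE (gP i).2//; exact/mem_set.
move=> x clx; apply/rowP => i; rewrite !mxE.
(* Since [x] is adherent to Omega, the limit along Omega is unique. *)
have pf : ProperFilter (within Omega (nbhs x)) by exact: within_nbhs_proper.
apply/cvg_lim => //.
have /subspace_continuousP/(_ x clx) gx := (gP i).1.
have {}gx : g i y @[y --> within Omega (nbhs x)] --> g i x.
  by apply: cvg_trans gx; apply: cvg_app; apply: within_subset; exact: subset_closure.
apply: cvg_trans gx; apply: near_eq_cvg.
by rewrite near_withinE; apply: nearW => y Oy; rewrite (gP i).2//; exact/mem_set.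
Qed.

Lemma Ck1_derive (R : realType) (n : nat) (Omega : set 'rV[R]_n)
    (u : 'rV[R]_n -> R) (x v : 'rV[R]_n) :
  open Omega -> Ck 1 Omega u -> Omega x ->
  derivable u x v /\ 'D_v u x = dotv v (gradient u x).
Proof.
move=> oO uC Ox.
suff H : h^-1 *: ((u \o shift x) (h *: v) - u x) @[h --> 0^'] --> dotv v (gradient u x).
  by split; [apply/cvg_ex; exists (dotv v (gradient u x))|exact/cvg_lim].
apply/cvgrPdist_le => e e0.
(* The [1] covers the case [v = 0]. *)
have e'0 : 0 < e / (`|v| + 1) by rewrite divr_gt0// ltr_wpDl.
have /nbhs_ballP[r /= r0 rP] := Ck1_expansion oO uC Ox e'0.
exists (r / (`|v| + 1)); first by rewrite /= divr_gt0// ltr_wpDl.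
move=> h /=; rewrite sub0r normrN => hr h0.
have hv : `|h *: v| < r.
  rewrite normrZ; apply: (@le_lt_trans _ _ (`|h| * (`|v| + 1))).
    by rewrite ler_wpM2l// lerDl.
  by rewrite -ltr_pdivlMr// ltr_wpDl.
have := rP (h *: v + x); rewrite -ball_normE/= opprD addrCA subrr addr0 normrN.
move=> /(_ hv); rewrite addrK dotvZl => H.
rewrite (_ : _ - _ = - (h^-1 * (u (h *: v + x) - u x - h * dotv v (gradient u x)))); last first.
  by rewrite mulrBr mulKf// opprB.
rewrite normrN normrM normfV mulrC ler_pdivrMr ?normr_gt0//.
apply: (le_trans H); rewrite normrZ mulrAC ler_pdivrMr ?ltr_wpDl//.
by rewrite -mulrA ler_wpM2l ?(ltW e0)// ler_wpM2l// lerDl.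
Qed.

Lemma interior_min_gradient (R : realType) (n : nat) (Omega : set 'rV[R]_n)
    (u : 'rV[R]_n -> R) (x p : 'rV[R]_n) :
  open Omega -> Ck 1 Omega u -> Omega x ->
  (forall y, Omega y -> u x - dotv p x <= u y - dotv p y) -> gradient u x = p.
Proof.
move=> oO uC Ox xmin; apply/eqP; rewrite -subr_eq0; apply/negPn/negP => d0.
set d := gradient u x - p in d0.
(* Otherwise [u - p.y] would decrease from x in the direction [- d]. *)
have dd0 := dotvv_gt0 d0.
have nd0 : 0 < `|d| by rewrite normr_gt0.
(* With this tolerance, the error at [x - t d] is at most [t d.d / 2], half of the first-order
   decrease [t d.d]. Here [|d|] is the sup norm. *)
have e0 : 0 < dotv d d / (2 * `|d|) by rewrite divr_gt0// mulr_gt0.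
have /nbhs_ballP[r /= r0 rP] : \forall y \near x, Omega y /\
    `|u y - u x - dotv (y - x) (gradient u x)| <= dotv d d / (2 * `|d|) * `|y - x|.
  by apply: filterI; [exact: oO|exact: (Ck1_expansion oO uC Ox e0)].
pose t := r / (2 * `|d|).
have t0 : 0 < t by rewrite divr_gt0// mulr_gt0.
have td : t * `|d| = r / 2 by rewrite /t; field; rewrite gt_eqF.
have [] := rP (x - t *: d).
  by rewrite -ball_normE/= opprB addrC subrK normrZ gtr0_norm// td; lra.
move=> /xmin; rewrite dotvBr dotvZr => h1.
have -> : x - t *: d - x = - (t *: d) by rewrite addrAC subrr add0r.
rewrite normrN normrZ gtr0_norm// td -scaleNr dotvZl.
have -> : dotv d d / (2 * `|d|) * (r / 2) = t * dotv d d / 2.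
  by rewrite /t; field; rewrite gt_eqF.
rewrite ler_norml => /andP[_ h2].
have h3 : dotv d (gradient u x) = dotv d d + dotv p d.
  by rewrite (dotvC p) -dotvDr /d subrK.
move: h2; rewrite h3 scaleNr => h2.
have h4 : 0 < t * dotv d d by rewrite mulr_gt0.
lra.
Qed.

(** For [y = x - t v], one has [(y - x).v = - t < - t/2]: the definition of the normal applies with
    [e = 1/2]. *)
Lemma outward_normal_inside (R : realType) (n : nat) (Omega : set 'rV[R]_n) (x v : 'rV[R]_n) :
  outward_unit_normal Omega x v ->
  exists2 r, 0 < r & forall t, 0 < t < r -> Omega (x - t *: v).
Proof.
move=> [v1 vP].
have h0 : 0 < 2^-1 :> R by [].
have /nbhs_ballP[r /= r0 rP] := vP _ h0.
exists r => // t /andP[t0 tr].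
have [] := rP (x - t *: v).
  rewrite -ball_normE/= opprB addrC subrK normrZ gtr0_norm// (le_lt_trans _ tr)//.
  by rewrite ler_piMr ?(ltW t0)// -v1 norm_le_enorm.
move=> h _; apply: h.
have -> : x - t *: v - x = - (t *: v) by rewrite addrAC subrr add0r.
rewrite -scaleNr dotvZl /enorm dotvZl dotvZr mulrA mulrNN.
have vv := enorm1 v1.
by rewrite vv !mulr1 -expr2 sqrtr_sqr gtr0_norm//; lra.
Qed.

(** Mean value theorem on a short segment from [x] in the direction [- v]: the derivative of
    [u - p.y] is [(p - g).v], negative near [x] by continuity of [g]. *)
Lemma boundary_not_min (R : realType) (n : nat) (Omega : set 'rV[R]_n)
    (u : 'rV[R]_n -> R) (g : 'rV[R]_n -> 'rV[R]_n) (x v p : 'rV[R]_n) :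
  open Omega -> Ck 1 Omega u -> {within closure Omega, continuous u} ->
  (forall i, {within closure Omega, continuous (fun x => g x ord0 i)}) ->
  (forall x, Omega x -> gradient u x = g x) ->
  closure Omega x -> outward_unit_normal Omega x v -> dotv p v < dotv (g x) v ->
  exists2 y, Omega y & u y - dotv p y < u x - dotv p x.
Proof.
move=> oO uC cu cg gE clx xv pg.
have [r1 r10 r1P] := outward_normal_inside xv.
have gv : dotv (g y) v @[y --> within (closure Omega) (nbhs x)] --> dotv (g x) v.
  apply: cvg_dotv => i; last exact: cvg_cst.
  by have /subspace_continuousP/(_ x clx) := cg i.
have : \forall y \near within (closure Omega) (nbhs x), dotv p v < dotv (g y) v.
  by have /cvgr_gt/(_ _ pg) := gv.
rewrite near_withinE => /nbhs_ballP[r2 /= r20 r2P].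
pose t0 := Num.min r1 r2 / 2.
have r0 : 0 < Num.min r1 r2 by rewrite lt_min r10.
have t00 : 0 < t0 by rewrite divr_gt0.
have t0r : t0 < Num.min r1 r2 by rewrite /t0; lra.
have [t0r1 t0r2] : t0 < r1 /\ t0 < r2 by apply/andP; rewrite -lt_min.
pose w := - v.
have inO t : 0 < t -> t <= t0 -> Omega (x + t *: w).
  by move=> tp tt0; rewrite /w scalerN; apply: r1P; rewrite tp (le_lt_trans tt0).
(* [f t] is the value of [u - p.y] at [x + t w], up to the constant [p.x]. *)
pose c := dotv p w.
pose f : R -> R := (fun t : R => u (x + t *: w)) - (c \*: id).
pose df (t : R) := 'D_w u (x + t *: w) - c *: 1.
have fd t : t \in `]0, t0[ -> is_derive t 1 f (df t).
  rewrite in_itv/= => /andP[tp tt0].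
  have h1 := is_derive_line (Ck1_derive w oO uC (inO _ tp (ltW tt0))).1.
  have h2 : is_derive t 1 (c \*: (id : R -> R)) (c *: 1) by exact: is_deriveZ.
  exact: is_deriveB.
(* At [t = 0] the point may be on the boundary, where [u] is continuous only relative to the
   closure; the segment stays in the closure. *)
have cf : {within `[0, t0], continuous f}.
  apply/subspace_continuousP => t; rewrite /= in_itv/= => /andP[tp tt0].
  apply: cvgB; last first.
    by apply: cvg_within_filter; apply: cvgZr; exact: cvg_id.
  have clt s : 0 <= s -> s <= t0 -> closure Omega (x + s *: w).
    rewrite le_eqVlt => /orP[/eqP <-|sp st0]; first by rewrite scale0r addr0.
    by apply: subset_closure; exact: inO.
  apply: (@cvg_comp _ _ _ (fun s : R => x + s *: w) u _
      (within (closure Omega) (nbhs (x + t *: w)))); last first.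
    by move/subspace_continuousP : cu; apply; exact: clt.
  move=> V; rewrite /within/= => VC.
  have cw : {for t, continuous (fun s : R => x + s *: w)}.
    by apply: cvgD; [exact: cvg_cst|apply: cvgZl; exact: cvg_id].
  have nV : \forall s \near t, closure Omega (x + s *: w) -> V (x + s *: w) := cw _ VC.
  change (\forall s \near t, `[0, t0]%classic s -> V (x + s *: w)).
  apply: filterS nV => s /= h; rewrite in_itv/= => /andP[s0 st].
  by apply: h; exact: clt.
have [t] := MVT t00 fd cf.
rewrite in_itv/= => /andP[tp tt0] E.
have Ot := inO _ tp (ltW tt0).
have gt : dotv p v < dotv (g (x + t *: w)) v.
  apply: r2P; last exact: subset_closure.
  rewrite -ball_normE/= opprD addNKr normrN normrZ gtr0_norm//.
  rewrite (le_lt_trans _ (lt_trans tt0 t0r2))// /w normrN.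
  by rewrite ler_piMr ?(ltW tp)// -xv.1 norm_le_enorm.
exists (x + t0 *: w); first exact: inO.
have : df t * (t0 - 0) < 0.
  rewrite subr0 pmulr_llt0// /df (Ck1_derive w oO uC Ot).2 gE//.
  rewrite [c *: 1]mulr1 /c dotvC {2 3}/w -scaleN1r !dotvZr !mulN1r; lra.
rewrite -E /f /= !fctE scale0r addr0 dotvDr dotvZr -/c.
rewrite [(c \*: id) t0]mulrC [(c \*: id) 0]mulr0; lra.
Qed.

(** [K] is cut out of the compact closure of Omega by closed conditions on [g]; the bound on the
    normal derivative keeps it away from the boundary. *)
Lemma contact_compact (R : realType) (n : nat) (Omega : set 'rV[R]_n)
    (nu : 'rV[R]_n -> 'rV[R]_n) (u : 'rV[R]_n -> R) (s : R) :
  bounded_domain Omega ->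
  (forall x, boundary Omega x -> outward_unit_normal Omega x (nu x)) ->
  C1_closure Omega u -> 0 < s ->
  (forall x, boundary Omega x -> s < normal_derivative Omega nu u x) ->
  [/\ measurable (lower_contact_set Omega u) &
  exists K, [/\ compact K, K `<=` lower_contact_set Omega u &
    eball 0 s `<=` gradient u @` K]].
Proof.
move=> [oO _ O0 bO] nuP uC1 s0 nd.
have [uC cu _] := uC1.
have [g [cg gE gextE]] := gradient_extension uC1.
have bnd x : closure Omega x -> ~ Omega x -> boundary Omega x.
  by move=> clx nOx; split=> // /interior_subset.
have gnu x : boundary Omega x -> s < dotv (g x) (nu x).
  by move=> bx; rewrite -gextE; [exact: nd|case: bx].
have clC : closed (closure Omega) by exact: closed_closure.
have cC : compact (closure Omega).
  apply: bounded_closed_compact => //.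
  have [M M0 OM] := bounded_setP bO.
  exists M; split; first exact: num_real.
  move=> N MN x clx.
  rewrite /= leNgt; apply/negP => Nx.
  have nV : \forall y \near x, N < `|y|.
    by have /cvgr_gt/(_ _ Nx) := @norm_continuous _ _ x.
  have [y [Oy]] := clx _ nV.
  by rewrite /= ltNge (le_trans (OM y Oy) (ltW MN)).
(* The contact points in the closure, with [g] as slope: an intersection of closed sets. Its trace
   on Omega is the lower contact set, which is therefore measurable. *)
pose A := [set x | closure Omega x /\ forall z, closure Omega z ->
  u x + dotv (g x) (z - x) <= u z].
have clA : closed A.
  rewrite (_ : A = closure Omega `&` \bigcap_(z in closure Omega)
      [set x | closure Omega x /\ u x + dotv (g x) (z - x) <= u z]).
    apply: closedI => //; apply: closed_bigI => z _.
    apply: closed_le_within => //; apply/subspace_continuousP => x clx.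
    apply: cvgD; first by move/subspace_continuousP : cu; exact.
    apply: cvg_dotv => i; first by have /subspace_continuousP/(_ x clx) := cg i.
    apply: cvg_within_filter; rewrite !mxE.
    under eq_cvg do rewrite !mxE.
    by apply: cvgB; [exact: cvg_cst|exact: coord_continuous].
  apply/seteqP; split=> x /= [clx h]; split=> // z clz; last exact: (h z clz).2.
  by split=> //; exact: h.
have AO : lower_contact_set Omega u = Omega `&` A.
  apply/seteqP; split=> x [Ox].
    by move=> h; split=> //; split; [exact: subset_closure|rewrite -gE].
  by move=> [_ h]; split=> //; rewrite gE.
split.
  rewrite AO; apply: measurableI; first exact: open_measurable_rV.
  exact: closed_measurable_rV.
pose B := [set x | closure Omega x /\ dotv (g x) (g x) <= s ^+ 2].
have clB : closed B.
  apply: closed_le_within => //; apply/subspace_continuousP => x clx.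
  by apply: cvg_dotv => i; have /subspace_continuousP/(_ x clx) := cg i.
have BO x : B x -> Omega x.
  move=> [clx gs]; apply: contrapT => nOx.
  have bx := bnd _ clx nOx.
  have := gnu _ bx; rewrite ltNge => /negP; apply.
  exact: (dotv_unit_le (ltW s0) gs (nuP _ bx).1).
exists (A `&` B); split.
- apply: (subclosed_compact _ cC); first exact: closedI.
  by move=> x [_ []].
- by rewrite AO => x [Ax /BO].
move=> p; rewrite /eball /= subr0 => ps.
have pp : dotv p p <= s ^+ 2.
  rewrite -(sqr_sqrtr (dotvv_ge0 p)) -/(enorm p).
  by rewrite lerXn2r ?nnegrE ?sqrtr_ge0 ?ltW.
have cq : {within closure Omega, continuous (fun y => u y - dotv p y)}.
  apply/subspace_continuousP => x clx.
  apply: cvgB; first by move/subspace_continuousP : cu; exact.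
  apply: cvg_dotv => i; first exact: cvg_cst.
  by apply: cvg_within_filter; exact: coord_continuous.
have C0 : closure Omega !=set0 by case: O0 => x Ox; exists x; exact: subset_closure.
have [x /set_mem clx xmin] := compact_EVT_min C0 cC cq.
have {}xmin y : closure Omega y -> u x - dotv p x <= u y - dotv p y.
  by move=> cly; apply: xmin; exact: mem_set.
have Ox : Omega x.
  apply: contrapT => nOx; have bx := bnd _ clx nOx.
  have [|y Oy] := boundary_not_min oO uC cu cg gE clx (nuP _ bx) (p := p).
    apply: le_lt_trans (gnu _ bx).
    exact: (dotv_unit_le (ltW s0) pp (nuP _ bx).1).
  by rewrite ltNge xmin//; exact: subset_closure.
have gp : gradient u x = p.
  apply: (interior_min_gradient oO uC Ox) => y Oy.
  by apply: xmin; exact: subset_closure.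
exists x => //; split.
  split=> // z clz; rewrite -gE// gp dotvBr; have := xmin z clz; lra.
by split=> //; rewrite -gE// gp.
Qed.

(** * Volume of Euclidean balls *)

Lemma open_eball (R : realType) (n : nat) (r : R) : open (eball (0 : 'rV[R]_n) r).
Proof.
rewrite openE => x xr; rewrite /interior.
have cd : dotv (y - 0) (y - 0) @[y --> x] --> dotv (x - 0) (x - 0).
  by apply: (@cvg_dotv _ _ _ _ (nbhs_filter x)) => i; rewrite subr0; under eq_cvg do rewrite subr0;
    exact: coord_continuous.
have c : enorm (y - 0) @[y --> x] --> enorm (x - 0).
  exact: (continuous_cvg _ (@sqrt_continuous R _) cd).
by have /cvgr_lt/(_ _ xr) := c.
Qed.

Lemma measurable_eball (R : realType) (n : nat) (r : R) :
  measurable (eball (0 : 'rV[R]_n) r).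
Proof. by apply: open_measurable_rV; exact: open_eball. Qed.

Lemma lebesgue_rV_eball (R : realType) (n : nat) (r : R) : 0 < r ->
  lebesgue_rV R n (eball 0 r) = ((r ^+ n)%:E * lebesgue_rV R n (eball 0 1))%E.
Proof.
move=> r0.
have rV0 : 0 < r^-1 by rewrite invr_gt0.
rewrite -[r in r ^+ n]invrK exprVn -(lebesgue_rV_homothety 0 rV0); last exact: measurable_eball.
congr (lebesgue_rV R n _); apply/seteqP.
have E (y : 'rV[R]_n) : enorm (r^-1 *: y + 0 - 0) = r^-1 * enorm y.
  rewrite addr0 subr0 /enorm dotvZl dotvZr mulrA -expr2 sqrtrM ?sqr_ge0//.
  by rewrite sqrtr_sqr gtr0_norm.
by split=> y; rewrite /eball /= E subr0 mulrC ltr_pdivrMr// mul1r.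
Qed.

(** The unit ball contains a cube of positive side and lies in the unit ball of the sup norm. *)
Lemma lebesgue_rV_unit_eball (R : realType) (n : nat) :
  exists2 b : R, 0 < b & lebesgue_rV R n (eball 0 1) = b%:E.
Proof.
have fin : lebesgue_rV R n (eball 0 1) \is a fin_num.
  rewrite ge0_fin_numE//; apply: (@lebesgue_rV_bounded _ _ _ 1) => //.
    exact: measurable_eball.
  by move=> x; rewrite /eball /= subr0 => /ltW; exact/le_trans/norm_le_enorm.
exists (fine (lebesgue_rV R n (eball 0 1))); last by rewrite fineK.
rewrite -lte_fin fineK//.
(* On the cube [[0, d]^n], [|x|^2 <= n d < 1] because [d <= 1]. *)
pose d : R := n.+1%:R^-1.
have d0 : 0 < d by rewrite invr_gt0 ltr0n.
apply: (@lt_le_trans _ _ (lebesgue_rV R n (cube 0 d))).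
  by rewrite lebesgue_rV_cube ?(ltW d0)// lte_fin exprn_gt0.
apply: le_measure; [apply: mem_set; exact: measurable_cbox|apply: mem_set; exact: measurable_eball|].
move=> x xd; rewrite /eball /= subr0 -[ltRHS]sqrtr1 ltr_sqrt//.
apply: (@le_lt_trans _ _ (\sum_(i < n) d)).
  apply: ler_sum => i _; have := xd i; rewrite !mxE add0r => /andP[h1 h2].
  have d1 : d <= 1 by rewrite invf_le1 ?ltr0n// ler1n.
  by rewrite -[leRHS]mulr1 ler_pM// (le_trans h2).
by rewrite sumr_const card_ord -mulr_natl ltr_pdivrMr ?ltr0n// mul1r ltr_nat.
Qed.

(** * The gradient map and the final estimate *)

Lemma det_continuous_at (R : realType) (n : nat) (T : Type) (F : set_system T)
    (FF : Filter F) (A : T -> 'M[R]_n) (B : 'M[R]_n) :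
  (forall i j, A t i j @[t --> F] --> B i j) -> \det (A t) @[t --> F] --> \det B.
Proof.
move=> AB; rewrite /determinant; apply: (@cvg_big _ _ +%R 0 xpredT) => [|s _].
  by move=> z; exact: add_continuous.
apply: cvgM; first exact: cvg_cst.
apply: (@cvg_big _ _ ( *%R : R -> R -> R) 1 xpredT) => [|i _].
  by move=> z; exact: mul_continuous.
exact: AB.
Qed.

(** The ball is covered by the image of [K] under the gradient; the area inequality applies with
    derivative the Hessian, and [K] lies in the contact set. *)
Lemma ball_measure_le (R : realType) (n : nat)
    (Omega : set 'rV[R]_n) (nu : 'rV[R]_n -> 'rV[R]_n) (u : 'rV[R]_n -> R) (s : R) :
  bounded_domain Omega ->
  (forall x, boundary Omega x -> outward_unit_normal Omega x (nu x)) ->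
  Ck 2 Omega u -> C1_closure Omega u -> 0 < s ->
  (forall x, boundary Omega x -> s < normal_derivative Omega nu u x) ->
  (lebesgue_rV R n (eball 0 s) <=
   \int[lebesgue_rV R n]_(x in lower_contact_set Omega u) `|\det (hessian u x)|%:E)%E.
Proof.
move=> domO nuP uC2 uC1 s0 nd.
have [mG [K [cK KG sK]]] := contact_compact domO nuP uC1 s0 nd.
have [oO _ _ _] := domO.
have GO : lower_contact_set Omega u `<=` Omega by move=> x [].
have KO := subset_trans KG GO.
have pC i : Ck 1 Omega (partial i u) by case: uC2 => _ /(_ i) [].
have cF x : Omega x -> {for x, continuous (gradient u)}.
  move=> Ox; apply: coord_cvg_rV => i; have [c _] := pC i.
  by rewrite (_ : (fun y => _) = partial i u); [exact: c|apply/funext => y; rewrite mxE].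
have cD x : Omega x -> {for x, continuous (fun x => `|\det (hessian u x)|)}.
  move=> Ox.
  suff c : \det (hessian u y) @[y --> x] --> \det (hessian u x) by exact: cvg_norm c.
  apply: (@det_continuous_at _ _ _ _ (nbhs_filter x)) => i j.
  rewrite mxE; under eq_cvg do rewrite mxE.
  by have [_ /(_ i) [_ [c _]]] := pC j; exact: c.
have cFK : {within K, continuous (gradient u)}.
  by apply: continuous_in_subspaceT => x /set_mem/KO; exact: cF.
apply: (@le_trans _ _ (lebesgue_rV R n (gradient u @` K))).
  apply: le_measure => //; apply: mem_set; first exact: measurable_eball.
  by apply: compact_measurable_rV; exact: continuous_compact.
apply: (@le_trans _ _ (\int[lebesgue_rV R n]_(x in K) `|\det (hessian u x)|%:E)%E).
  apply: area_le => //.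
    by apply: continuous_in_subspaceT => x /set_mem/KO; exact: cD.
  move=> x /KO Ox e e0.
  have H : \forall y \near x, forall i,
      `|partial i u y - partial i u x - dotv (y - x) (gradient (partial i u) x)| <=
      e * `|y - x|.
    exact: (@filter_forall _ _ (fun i y => `|partial i u y - partial i u x -
      dotv (y - x) (gradient (partial i u) x)| <= e * `|y - x|) (nbhs x) _
      (fun i => Ck1_expansion oO (pC i) Ox e0)).
  apply: filterS H => y h; apply: norm_rV_le => [|i]; first by rewrite mulr_ge0// ltW.
  apply: le_trans (h i); rewrite !mxE.
  (* For row vectors, coordinate [i] of [(y - x) *m hessian u x] is the differential at [x] of the
     [i]-th partial derivative. *)
  rewrite (_ : dotv _ _ = \sum_j (y - x) ord0 j * hessian u x j i)//.
  by apply: eq_bigr => j _; rewrite !mxE.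
apply: ge0_subset_integral => //; first exact: compact_measurable_rV.
apply: (@measurable_funS _ _ _ _ Omega) => //; first exact: open_measurable_rV.
apply/measurable_EFinP; apply: measurable_fun_within.
by apply: continuous_in_subspaceT => x /set_mem; exact: cD.
Qed.

(** For every real [s] with [0 < s < m], [s^n |B_1| = |B_s| <= I]; then [s] tends to [m]. Extended
    reals allow [I] to be infinite. *)
Theorem theorem3p1 (R : realType) (n : nat) (n_gt0 : (0 < n)%N)
    (Omega : set 'rV[R]_n) (nu : 'rV[R]_n -> 'rV[R]_n)
    (u : 'rV[R]_n -> R) (f : 'rV[R]_n -> R -> 'rV[R]_n -> R)
    (domO : bounded_domain Omega)
    (nu_normal : forall x, boundary Omega x -> outward_unit_normal Omega x (nu x))
    (uC2 : Ck 2 Omega u) (uC1 : C1_closure Omega u)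
    (monge_ampere : forall x, Omega x ->
      \det (hessian u x) = f x (u x) (gradient u x))
    (inf_gt0 : (0 < ereal_inf
      [set (normal_derivative Omega nu u x)%:E | x in boundary Omega])%E) :
  (ereal_inf [set (normal_derivative Omega nu u x)%:E | x in boundary Omega] <=
   ((\int[lebesgue_rV R n]_(x in lower_contact_set Omega u)
       `|f x (u x) (gradient u x)|%:E) / lebesgue_rV R n (eball 0 1))
   `^ n%:R^-1)%E.
Proof.
set m := ereal_inf _ in inf_gt0 *.
set I := (\int[_]_(x in _) _)%E.
have [b b0 bE] := lebesgue_rV_unit_eball R n.
have IE : I = (\int[lebesgue_rV R n]_(x in lower_contact_set Omega u)
    `|\det (hessian u x)|%:E)%E.
  by apply: eq_integral => x /set_mem[Ox _]; rewrite monge_ampere.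
have key (s : R) : 0 < s -> (s%:E < m)%E -> (s%:E <= (I / b%:E) `^ n%:R^-1)%E.
  move=> s0 sm.
  have nd x : boundary Omega x -> s < normal_derivative Omega nu u x.
    move=> bx; rewrite -lte_fin; apply: lt_le_trans sm _.
    by apply: ereal_inf_lbound; exists x.
  have := ball_measure_le domO nu_normal uC2 uC1 s0 nd.
  rewrite (lebesgue_rV_eball _ s0) bE -IE muleC => sI.
  have -> : s%:E = ((s ^+ n)%:E `^ n%:R^-1)%E.
    rewrite poweR_EFin -powR_mulrn ?(ltW s0)// -powRrM mulfV ?pnatr_eq0 -?lt0n//.
    by rewrite powRr1// ltW.
  have sIb : ((s ^+ n)%:E <= I / b%:E)%E.
    by rewrite inver gt_eqF// lee_pdivlMr// muleC.
  have sn0 : (0 <= (s ^+ n)%:E)%E by rewrite lee_fin exprn_ge0// ltW.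
  apply: gt0_ler_poweR => //; rewrite ?invr_ge0 ?ler0n// in_itv/= leey andbT//.
  exact: le_trans sIb.
(* If the right-hand side were a real [y < m], then [s = (y + m)/2], or [s = y + 1] when [m] is
   infinite, would contradict [key]. *)
rewrite bE leNgt; apply/negP.
case yE : ((I / b%:E) `^ n%:R^-1)%E key => [y| |] key.
- have y0 : 0 <= y by rewrite -lee_fin -yE poweR_ge0.
  case mE : m inf_gt0 key => [m'| |] // _ key ym.
  + rewrite lte_fin in ym.
    have := key ((y + m') / 2); rewrite !lte_fin lee_fin => h.
    have : (y + m') / 2 <= y by apply: h; lra.
    lra.
  + have := key (y + 1); rewrite ltry lee_fin => h.
    have : y + 1 <= y by apply: h => //; lra.
    lra.
- by rewrite ltNge leey.
- by have := poweR_ge0 (I / b%:E)%E n%:R^-1; rewrite yE.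
Qed.
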